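(* Let $\mathcal{X}$ be a class of abelian groups. (i) If $\mathcal{EB}\subseteq\mathcal{X}\subseteq\mathcal{DF}$, then $\mathcal{X}_h=\mathcal{EB}$. (ii) If $\mathcal{B}\subseteq\mathcal{X}\subseteq\mathcal{H}$, then $\mathcal{X}_h=\mathcal{B}$.
   Context: All groups are abelian; a class is closed under isomorphism. $\mathcal{B}$: Bassian groups ($G$ Bassian iff there is no nonzero $H\le G$ with an injective homomorphism $G\to G/H$). $\mathcal{H}$: Hopfian groups ($G$ Hopfian iff $G\not\cong G/H$ for every nonzero subgroup $H$; equivalently every surjective endomorphism is injective). $\mathcal{DF}$: directly finite groups ($G$ not isomorphic to a proper direct summand of itself, i.e. no $G=A\oplus C$ with $C\ne0$, $A\cong G$). $\mathcal{EB}$: Extended Bassian groups, i.e. groups $B\oplus D$ with $B$ Bassian and $D=\bigoplus_{p\ \text{prime}}\mathbb{Z}(p^\infty)^{(n_p)}$, each $n_p$ finite. For a class $\mathcal{X}$, $\mathcal{X}_h=\{G\in\mathcal{X}:\text{every subgroup of }G\text{ is in }\mathcal{X}\}$. *)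

(* Defs.v *)
From HB Require Import structures.
From mathcomp Require Import all_boot all_order all_algebra.
Set Implicit Arguments. Unset Strict Implicit. Unset Printing Implicit Defensive.
Import Order.TTheory GRing.Theory Num.Theory.
Local Open Scope ring_scope.

Definition iso_grp (G H : zmodType) : Prop :=
  exists f : {additive G -> H}, bijective f.

Definition iso_closed (X : zmodType -> Prop) : Prop :=
  forall G H : zmodType, iso_grp G H -> X G -> X H.

Definition subclass (X Y : zmodType -> Prop) : Prop := forall G, X G -> Y G.
Definition same_class (X Y : zmodType -> Prop) : Prop := forall G, X G <-> Y G.

Definition is_subgroup (G : zmodType) (S : G -> Prop) : Prop :=
  S 0 /\ (forall x y, S x -> S y -> S (x - y)).

(* Bassian: there is no nonzero subgroup H and injective hom G -> G/H.
   The quotient G/H is represented (up to isomorphism) by a zmodType Q with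
   a surjective homomorphism pi : G -> Q of kernel H; H is nonzero iff pi is
   not injective. *)
Definition Bassian (G : zmodType) : Prop :=
  forall (Q : zmodType) (pi : {additive G -> Q}) (f : {additive G -> Q}),
    (forall q, exists g, pi g = q) -> injective f -> injective pi.

Definition Hopfian (G : zmodType) : Prop :=
  forall f : {additive G -> G}, (forall y, exists x, f x = y) -> injective f.

(* directly finite: no G = A (+) C (internal direct sum) with C <> 0, A ~= G.
   The subgroup A isomorphic to G is the image of an injective endomorphism f. *)
Definition directly_finite (G : zmodType) : Prop :=
  ~ exists (f : {additive G -> G}) (C : G -> Prop),
      [/\ injective f, is_subgroup C, (exists c, C c /\ c <> 0),
          (forall a c, C c -> f a = c -> c = 0) &
          (forall g, exists a c, C c /\ g = f a + c)].

(* Q/Z, represented by rationals in [0,1) *)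
Definition fracQ (x : rat) : rat := x - (Num.floor x)%:~R.

(* D ~= (+)_{p prime} Z(p^oo)^(n p).  Z(p^oo) is modelled as the subgroup of
   Q/Z of elements with p-power denominator.  An element of the direct sum is
   a family f p i (p prime, i < n p) with finite support. *)
Definition divsum_elt (n : nat -> nat) (f : nat -> nat -> rat) : Prop :=
  [/\ (forall p i, 0 <= f p i < 1),
      (forall p i, exists k, denq (f p i) = (p ^ k)%N%:Z),
      (forall p i, (~~ prime p \/ (n p <= i)%N) -> f p i = 0) &
      (exists N, forall p i, (N <= p)%N -> f p i = 0)].

Definition iso_divsum (D : zmodType) (n : nat -> nat) : Prop :=
  exists phi : D -> (nat -> nat -> rat),
    [/\ injective phi,
        (forall x, divsum_elt n (phi x)),
        (forall f, divsum_elt n f -> exists x, phi x = f) &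
        (forall x y p i, phi (x + y) p i = fracQ (phi x p i + phi y p i))].

Definition ext_Bassian (G : zmodType) : Prop :=
  exists (B D : zmodType) (n : nat -> nat),
    [/\ Bassian B, iso_divsum D n & iso_grp G (B * D)%type].

(* X_h: groups in X all of whose subgroups are in X.  A subgroup of G is
   represented (up to isomorphism; X is isomorphism-closed) by a group K with
   an injective homomorphism K -> G. *)
Definition hered (X : zmodType -> Prop) (G : zmodType) : Prop :=
  X G /\ forall (K : zmodType) (e : {additive K -> G}), injective e -> X K.

(* Main.v *)
(* Write r_0 for the torsion-free rank and T_p for the p-torsion part.  A group is
   Bassian iff r_0 is finite and every T_p is finite; it is extended Bassian iff
   r_0 and all socles G[p] are finite, since then p^k T_p is divisible for some k
   and the largest divisible torsion subgroup splits off.  Both conditions pass to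
   subgroups.  Conversely a group of infinite r_0 or infinite G[p] contains a free
   group or a Z/p-space of countable rank, i.e. the additive group of Z[X] or
   (Z/p)[X], which is neither directly finite (multiply by X) nor Hopfian (divide
   by X); and if G[p] is finite but T_p is not, G contains a divisible group on
   which p is onto and not injective.

   The necessity of the rank conditions for Bassian groups rests on one remark.
   Let K <= G, let Theta, Phi : G -> E be such that Theta maps K onto E with nonzero
   kernel and Phi is injective on K.  Then (Theta, [.]) : G -> E * G/K is onto with
   nonzero kernel and (Phi, [.]) is injective, so G is not Bassian.  Such Theta and
   Phi are obtained by extending maps from K, with E divisible, or injective among
   groups of exponent m and K meeting mG trivially. *)
Require Import Defs.
From HB Require Import structures.
From mathcomp Require Import all_boot all_order all_algebra.
From mathcomp Require Import generic_quotient ring_quotient zify ring.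
From mathcomp Require Import boolp classical_sets cardinality.
Set Implicit Arguments. Unset Strict Implicit. Unset Printing Implicit Defensive.
Import Order.TTheory GRing.Theory Num.Theory.
Local Open Scope ring_scope.
Local Open Scope classical_set_scope.

(** * Extension of homomorphisms *)

Section Subgroups.
Variables (G : zmodType) (S : G -> Prop) (subgS : is_subgroup S).

(** The proof of [is_subgroup S] is an argument so that the closure properties can be attached to
    the predicate as an instance, on which the subgroup type and the quotient rest. *)
Definition subgroup_pred of is_subgroup S : {pred G} := fun x => `[< S x >].
Let P := subgroup_pred subgS.

Fact subgroup_pred_closed : zmod_closed P.
Proof.
by split=> [|x y /asboolP Sx /asboolP Sy]; apply/asboolP; [case: subgS|exact: subgS.2].
Qed.

HB.instance Definition _ := GRing.isZmodClosed.Build G P subgroup_pred_closed.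

Definition subgroup_sig := {x : G | P x}.
HB.instance Definition _ := [isSub of subgroup_sig for sval].
HB.instance Definition _ := [Choice of subgroup_sig by <:].
HB.instance Definition _ := [SubChoice_isSubZmodule of subgroup_sig by <:].

Lemma subgroup_type : exists (K : zmodType) (e : {additive K -> G}),
  injective e /\ forall g, S g <-> exists k, e k = g.
Proof.
exists subgroup_sig, (val : {additive subgroup_sig -> G}); split; first exact: val_inj.
move=> g; split=> [/asboolP Sg|[[x /asboolP Sx] <-//]].
by exists (exist _ g Sg).
Qed.

Lemma quotient_type : exists (Q : zmodType) (pi : {additive G -> Q}),
  (forall q, exists g, pi g = q) /\ forall g, pi g = 0 <-> S g.
Proof.
pose I : zmodClosed G := P.
exists (Quotient.quot I), (\pi_(Quotient.quot I)%qT : {additive G -> Quotient.quot I}).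
split=> [q|g]; first by exists (repr q); exact: reprK.
have -> : S g <-> g - 0 \in I by rewrite subr0; split=> /asboolP.
rewrite (Quotient.idealrBE I g 0) -(rwP eqP).
by rewrite (raddf0 (\pi_(Quotient.quot I)%qT : {additive G -> Quotient.quot I})).
Qed.

End Subgroups.

Lemma additive_of (G E : zmodType) (f : G -> E) : zmod_morphism f ->
  exists F : {additive G -> E}, F =1 f.
Proof.
move=> fB; pose F : {additive G -> E} := HB.pack f (GRing.isZmodMorphism.Build G E f fB).
by exists F.
Qed.

(* With m = 0 (so k = 0) this is divisibility; with m > 0 it holds for sums of
   copies of Z/m. *)
Definition divisible_mod (m : nat) (E : zmodType) : Prop :=
  forall (d k : nat) (e : E), (0 < d)%N -> (d * k)%N = m -> e *+ k = 0 ->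
    exists u, e = u *+ d.

(** A partial homomorphism is handled through its graph. Single-valuedness is stated apart, as
    [Gam 0 e -> e = 0]. *)
Definition additive_graph (G E : zmodType) (Gam : G -> E -> Prop) : Prop :=
  is_subgroup (fun u : (G * E)%type => Gam u.1 u.2).

Lemma subgroupN (G : zmodType) (S : G -> Prop) : is_subgroup S ->
  forall x, S x -> S (- x).
Proof. by case=> S0 SB x Sx; rewrite -sub0r; apply: SB. Qed.

Lemma subgroupD (G : zmodType) (S : G -> Prop) : is_subgroup S ->
  forall x y, S x -> S y -> S (x + y).
Proof. by move=> SS x y Sx Sy; rewrite -[y]opprK; apply: SS.2 => //; apply: subgroupN. Qed.

Lemma subgroupMn (G : zmodType) (S : G -> Prop) : is_subgroup S ->
  forall x n, S x -> S (x *+ n).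
Proof.
move=> SS x n Sx; elim: n => [|n IH]; first by rewrite mulr0n; case: SS.
by rewrite mulrS; apply: subgroupD.
Qed.

Lemma subgroupMz (G : zmodType) (S : G -> Prop) : is_subgroup S ->
  forall x n, S x -> S (x *~ n).
Proof.
move=> SS x [n|n] Sx; first exact: subgroupMn.
by rewrite NegzE mulrNz; apply: subgroupN => //; apply: (@subgroupMn _ _ SS).
Qed.

Section AdditiveGraph.
Variables (G E : zmodType) (Gam : G -> E -> Prop).
Hypothesis GG : additive_graph Gam.

Lemma graphB g e h f : Gam g e -> Gam h f -> Gam (g - h) (e - f).
Proof. exact: (GG.2 (g, e) (h, f)). Qed.

Lemma graphMn g e n : Gam g e -> Gam (g *+ n) (e *+ n).
Proof.
move=> /(subgroupMn GG (x := (g, e)) n).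
by have := raddfMn (@fst G E) n (g, e); have := raddfMn (@snd G E) n (g, e) => /= -> ->.
Qed.

Lemma graphMz g e n : Gam g e -> Gam (g *~ n) (e *~ n).
Proof.
move=> /(subgroupMz GG (x := (g, e)) n).
by have := raddfMz (@fst G E) n (g, e); have := raddfMz (@snd G E) n (g, e) => /= -> ->.
Qed.

End AdditiveGraph.

Lemma int_subgroup (S : int -> Prop) : is_subgroup S ->
  exists d : nat, forall n, S n <-> (d%:Z %| n)%Z.
Proof.
move=> SS.
have [[d [d_gt0 Sd]]|noS] := pselect (exists d : nat, (0 < d)%N /\ S d).
  pose Q d := (0 < d)%N && `[< S (d : nat) >].
  have exQ : exists d, Q d by exists d; rewrite /Q d_gt0; apply/asboolP.
  have [e /andP[e_gt0 /asboolP Se] e_min] := ex_minnP exQ.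
  exists e => n; split=> [Sn|/dvdzP[q ->]]; last first.
    by rewrite mulrC -[_ * q]mulrzz; apply: subgroupMz.
  have Sr : S (n %% e)%Z.
    have -> : (n %% e)%Z = n - e%:Z *~ (n %/ e)%Z.
      by rewrite mulrzz mulrC.
    by apply: SS.2 => //; apply: subgroupMz.
  have [r Er] : exists r : nat, (n %% e)%Z = r.
    by exists `|(n %% e)%Z|%N; rewrite gez0_abs // modz_ge0 // gt_eqF.
  have r_lt : (r < e)%N by rewrite -ltz_nat -Er ltz_pmod.
  apply/dvdz_mod0P; rewrite Er; case: r Er r_lt => // r Er r_lt.
  by have := e_min r.+1; rewrite leqNgt r_lt /Q /=; case: asboolP => [_ /(_ isT)//|]; rewrite -Er.
exists 0%N => n; rewrite dvd0z; split=> [Sn|/eqP->]; last by case: SS.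
apply/negP => n0; apply: noS; exists `|n|%N; rewrite absz_gt0; split; first exact/negP.
by case: {n0}n Sn => // n /(subgroupN SS).
Qed.

Section Extension.
Variables (G E : zmodType) (m : nat).
Hypothesis divE : divisible_mod m E.

(** The integers [n] with [x *~ n] in the domain form dZ, and [d] divides [m]. If [d > 0], the value
    [ed] at [x *+ d] is killed by [m %/ d], so [divisible_mod] gives [u] with [ed = u *+ d]. If
    [d = 0], any [u] will do. *)
Lemma extend_step (Gam : G -> E -> Prop) (x : G) : additive_graph Gam ->
  (forall e, Gam 0 e -> e = 0) -> Gam (x *+ m) 0 ->
  exists u, forall (n : int) e, Gam (x *~ n) e -> e = u *~ n.
Proof.
move=> GG Gam0 Gamm.
have /int_subgroup[d dP] : is_subgroup (fun n : int => exists e, Gam (x *~ n) e).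
  split; first by exists 0; rewrite mulr0z; case: GG.
  by move=> a b [e He] [f Hf]; exists (e - f); rewrite mulrzBr; apply: graphB.
have [/= d0|d_gt0] := posnP d.
  exists 0 => n e xe; have /dP : exists e, Gam (x *~ n) e by exists e.
  by rewrite d0 dvd0z => /eqP n0; move: xe; rewrite n0 mulr0z mul0rz; apply: Gam0.
have [ed Hed] : exists e, Gam (x *~ d) e by apply/dP; rewrite dvdzz.
have dm : (d %| m)%N by rewrite -[(d %| m)%N]/(d%:Z %| m%:Z)%Z; apply/dP; exists 0.
have [u edu] : exists u, ed = u *+ d.
  apply: (divE d_gt0 (k := (m %/ d)%N)); first by rewrite mulnC divnK.
  apply: Gam0; rewrite -[_ *+ _]subr0 -(subrr (x *+ m)).
  apply: graphB => //.
  have -> : x *+ m = x *+ d *+ (m %/ d) by rewrite -mulrnA mulnC divnK.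
  exact: graphMn.
exists u => n e xe; have /dP/dvdzP[q nq] : exists e, Gam (x *~ n) e by exists e.
apply/eqP; rewrite -subr_eq0; apply/eqP/Gam0; rewrite -(subrr (x *~ n)).
apply: graphB => //; rewrite nq mulrC !mulrzA -[u *~ d]/(u *+ d) -edu.
exact: graphMz.
Qed.

Lemma extend_point (Gam : G -> E -> Prop) (x : G) : additive_graph Gam ->
  (forall e, Gam 0 e -> e = 0) -> Gam (x *+ m) 0 ->
  exists Del : G -> E -> Prop, [/\ additive_graph Del, forall e, Del 0 e -> e = 0,
    forall g e, Gam g e -> Del g e & exists u, Del x u].
Proof.
move=> GG Gam0 Gamm; have [u uP] := extend_step GG Gam0 Gamm.
exists (fun g e => exists n : int, Gam (g + x *~ n) (e + u *~ n)); split.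
- split; first by exists 0; rewrite /= !mulr0z !addr0; case: GG.
  move=> [g e] [h f] [a Ha] [b Hb]; exists (a - b) => /=.
  rewrite !mulrzBr addrACA -opprD [e - f + _]addrACA -opprD.
  exact: (graphB GG Ha Hb).
- move=> e [n]; rewrite add0r => /uP; rewrite -[RHS]add0r => /addIr; exact.
- by move=> g e ge; exists 0; rewrite !mulr0z !addr0.
- by exists u, (-1); rewrite !mulrN1z !subrr; case: GG.
Qed.

(* For m = 0 this is the injectivity of divisible groups; for m > 0 it is the
   injectivity of E among groups of exponent m, applied to G / mG. *)
Theorem additive_extension (Gam : G -> E -> Prop) : additive_graph Gam ->
  (forall g e, Gam (g *+ m) e -> e = 0) ->
  exists F : {additive G -> E}, forall g e, Gam g e -> F g = e.
Proof.
move=> GG Gamm.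
(* Putting mG into the domain with value 0 supplies the hypothesis on [x *+ m] that [extend_point]
   makes at each [x]. *)
pose Gam1 := [set u : (G * E)%type | exists h, Gam (u.1 + h *+ m) u.2].
have Gam1G : is_subgroup Gam1.
  split; first by exists 0; rewrite mul0rn addr0; case: GG.
  move=> [g e] [g' e'] [h Hh] [h' Hh']; exists (h - h') => /=.
  by rewrite mulrnBl addrACA -opprD; apply: (graphB GG Hh Hh').
have Gam1m h : Gam1 (h *+ m, 0) by exists (- h); rewrite /= mulNrn subrr; case: GG.
(* The condition bears on the union with [Gam1] so that the empty chain, whose union is [set0],
   satisfies it too. *)
pose P (A : set (G * E)%type) := is_subgroup (A `|` Gam1) /\ forall e, (A `|` Gam1) (0, e) -> e = 0.
have [F FP Ftot|A [[AS A0] Amax]] := @Zorn_bigcup _ P.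
  have down u v : (\bigcup_(X in F) X `|` Gam1) u -> (\bigcup_(X in F) X `|` Gam1) v ->
      exists2 X, P X & [/\ (X `|` Gam1) u, (X `|` Gam1) v &
                          X `<=` \bigcup_(X in F) X `|` Gam1].
    have P0 : P set0.
      rewrite /P set0U; split=> // e [h]; rewrite /= add0r; exact: Gamm.
    move=> [[X FX Xu]|Hu] [[Y FY Yv]|Hv].
    - have [XY|YX] := Ftot _ _ FX FY.
        exists Y; first exact: FP.
        by split; [left; apply: XY|left|move=> w Yw; left; exists Y].
      exists X; first exact: FP.
      by split; [left|left; apply: YX|move=> w Xw; left; exists X].
    - exists X; first exact: FP.
      by split; [left|right|move=> w Xw; left; exists X].
    - exists Y; first exact: FP.
      by split; [right|left|move=> w Xw; left; exists Y].
    - by exists set0 => //; split; [right|right|].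
  split; first split; first by right; case: Gam1G.
    move=> u v /down/[apply] -[X [[_ XB] _] [Xu Xv sX]].
    by have [/sX//|?] := XB _ _ Xu Xv; right.
  by move=> e H; have [X [_ XP] [Xe _ _]] := down _ _ H H; apply: XP.
pose Del g e := (A `|` Gam1) (g, e).
have DelG : additive_graph Del.
  by case: AS => S0 SB; split=> [//|[g e] [g' e']]; apply: SB.
have Deltot g : exists e, Del g e.
  have Delm : Del (g *+ m) 0 by right.
  have [Del' [DG D0 DD [u Du]]] := extend_point DelG A0 Delm.
  have [|nD] := pselect (Del g u); first by exists u.
  case: (Amax [set v | Del' v.1 v.2]).
    split=> [[a b] Aab|/(_ (g, u) Du) Au]; first by apply: DD; left.
    by case: nD; left.
  have EDel : [set v | Del' v.1 v.2] `|` Gam1 = [set v | Del' v.1 v.2].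
    by apply/setUidl => -[a b] Gab; apply: DD; right.
  by rewrite /P EDel.
have [f fP] := choice Deltot.
have fu g e : Del g e -> f g = e.
  move=> ge; apply/eqP; rewrite -subr_eq0; apply/eqP/A0.
  by rewrite -(subrr g); apply: (graphB DelG (fP g) ge).
have [F Ff] : exists F : {additive G -> E}, F =1 f.
  by apply: additive_of => x y; apply: fu; apply: (graphB DelG); exact: fP.
exists F => g e ge; rewrite Ff; apply: fu; right; exists 0.
by rewrite mul0rn addr0.
Qed.

End Extension.

Lemma additive_extension_hom (G E K : zmodType) (e : {additive K -> G})
    (f : {additive K -> E}) : divisible_mod 0 E -> injective e ->
  exists F : {additive G -> E}, forall k, F (e k) = f k.
Proof.
move=> divE ei.
have [||F FP] := additive_extension divE (Gam := fun g x => exists2 k, g = e k & x = f k).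
- split; first by exists 0; rewrite raddf0.
  by move=> [g x] [h y] [/= k -> ->] [l -> ->]; exists (k - l); rewrite raddfB.
- by move=> g x [k]; rewrite mulr0n -(raddf0 e) => /ei <- ->; rewrite raddf0.
- by exists F => k; apply: FP; exists k.
Qed.

Lemma not_Bassian (G E : zmodType) (K : G -> Prop) (Th Ph : {additive G -> E}) :
  is_subgroup K -> (forall e, exists2 k, K k & Th k = e) ->
  (exists k, [/\ K k, k <> 0 & Th k = 0]) ->
  (forall k, K k -> Ph k = 0 -> k = 0) -> ~ Bassian G.
Proof.
move=> KS Thsurj [k [Kk k0 Thk]] Phinj BG.
have [Q [q [qs qK]]] := quotient_type KS.
have [pi piE] : exists pi : {additive G -> (E * Q)%type}, pi =1 fun g => (Th g, q g).
  by apply: additive_of => x y; rewrite !raddfB.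
have [f fE] : exists f : {additive G -> (E * Q)%type}, f =1 fun g => (Ph g, q g).
  by apply: additive_of => x y; rewrite !raddfB.
apply: k0; apply: (BG _ pi f).
- move=> [e c]; have [g <-] := qs c; have [l Kl Thl] := Thsurj (e - Th g).
  by exists (l + g); rewrite piE !raddfD /= Thl subrK ((qK l).2 Kl) add0r.
- apply: raddf_inj => g; rewrite fE => -[Phg /qK Kg]; exact: Phinj.
- by rewrite raddf0 piE Thk ((qK k).2 Kk).
Qed.

(** * Linear combinations of a sequence *)

Section LinearCombination.
Variable G : zmodType.
Implicit Types (b : nat -> G) (c : {poly int}).

(* Finitely supported integer families are encoded as {poly int}, so that linear
   combinations of a sequence form an additive map out of Z[X]. *)
Definition lc_fun b c : G := \sum_(i < size c) b i *~ c`_i.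

Lemma lc_funE b c n : (size c <= n)%N -> lc_fun b c = \sum_(i < n) b i *~ c`_i.
Proof.
move=> cn; rewrite /lc_fun (big_ord_widen n (fun i => b i *~ c`_i) cn) big_mkcond /=.
apply: eq_bigr => i _; case: ltnP => // ci.
by rewrite nth_default // mulr0z.
Qed.

Fact lc_is_zmod_morphism b : zmod_morphism (lc_fun b).
Proof.
move=> c d; set n := maxn (size c) (size d).
rewrite (@lc_funE b _ n) ?(leq_trans (size_polyD _ _)) ?size_polyN //.
rewrite (@lc_funE b c n) ?leq_maxl // (@lc_funE b d n) ?leq_maxr //.
by rewrite -sumrB; apply: eq_bigr => i _; rewrite coefB mulrzBr.
Qed.

HB.instance Definition _ b :=
  GRing.isZmodMorphism.Build {poly int} G (lc_fun b) (lc_is_zmod_morphism b).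

Definition lc b : {additive {poly int} -> G} := lc_fun b.

Lemma lcXn b i : lc b 'X^i = b i.
Proof.
rewrite /lc /= /lc_fun size_polyXn big_ord_recr /= coefXn eqxx mulr1z.
by rewrite big1 ?add0r // => j _; rewrite coefXn ltn_eqF // mulr0z.
Qed.

Lemma lc_eq0 b (o : nat -> nat) c : (forall i, b i *+ o i = 0) ->
  (forall i, (o i %| c`_i)%Z) -> lc b c = 0.
Proof.
move=> bo oc; rewrite /lc /= /lc_fun big1 // => i _.
by have /dvdzP[q ->] := oc i; rewrite mulrC mulrzA -[b i *~ o i]/(b i *+ o i) bo mul0rz.
Qed.

Lemma eq_lc b b' c : (forall i, (i < size c)%N -> b i = b' i) -> lc b c = lc b' c.
Proof. by move=> bb'; apply: eq_bigr => i _; rewrite bb'. Qed.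

End LinearCombination.

Lemma raddf_lc (G H : zmodType) (f : {additive G -> H}) b c :
  f (lc b c) = lc (f \o b) c.
Proof. by rewrite /lc /= /lc_fun raddf_sum; apply: eq_bigr => i _; rewrite raddfMz. Qed.

(** The [b i] are independent of orders [o i] (0 for infinite order) and span a subgroup K meeting
    mG trivially. Maps on K can be prescribed on the [b i] and extended to G: Theta sends [b i] to
    [y i], and is onto since [y] enumerates E; Phi sends [b i] to [z i]. An index with [y i = 0]
    gives the kernel element of Theta, nonzero since [o i != 1]. *)
Lemma independent_not_Bassian (G E : zmodType) (m : nat) (b : nat -> G)
    (o : nat -> nat) (y z : nat -> E) : divisible_mod m E ->
  (forall i, b i *+ o i = 0) ->
  (forall c g, lc b c = g *+ m -> forall i, (o i %| c`_i)%Z) ->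
  (forall i, o i != 1%N) ->
  (forall i, y i *+ o i = 0) -> (forall e, exists i, y i = e) ->
  (forall i, z i *+ o i = 0) -> (forall c, lc z c = 0 -> forall i, (o i %| c`_i)%Z) ->
  ~ Bassian G.
Proof.
move=> divE bo bindep o1 yo ysurj zo zindep.
have ext (w : nat -> E) : (forall i, w i *+ o i = 0) ->
    exists F : {additive G -> E}, forall c, F (lc b c) = lc w c.
  move=> wo.
  have [||F FP] := additive_extension divE
    (Gam := fun g e => exists2 c, g = lc b c & e = lc w c).
  - split; first by exists 0; rewrite raddf0.
    by move=> [g e] [h f] [/= c -> ->] [d -> ->]; exists (c - d); rewrite raddfB.
  - by move=> g e [c /esym/bindep oc ->]; apply: lc_eq0 oc.
  - by exists F => c; apply: FP; exists c.
have [Th ThE] := ext _ yo; have [Ph PhE] := ext _ zo.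
apply: (@not_Bassian G E (fun g => exists c, g = lc b c) Th Ph).
- split=> [|_ _ [c ->] [d ->]]; first by exists 0; rewrite raddf0.
  by exists (c - d); rewrite raddfB.
- by move=> e; have [i <-] := ysurj e; exists (lc b 'X^i); [exists 'X^i|rewrite ThE lcXn].
- have [i yi] := ysurj 0; exists (b i); split; first by exists 'X^i; rewrite lcXn.
    move=> bi0; have := @bindep 'X^i 0; rewrite lcXn bi0 mul0rn.
    move=> /(_ erefl i); rewrite coefXn eqxx dvdz1 /= => oi1.
    by move: (o1 i); rewrite oi1.
  by rewrite -(lcXn b) ThE lcXn.
- by move=> _ [c ->]; rewrite PhE => /zindep; apply: lc_eq0.
Qed.

Lemma lcZXn (G : zmodType) (b : nat -> G) (a : int) i : lc b (a *: 'X^i) = b i *~ a.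
Proof. by rewrite -[a]intz scaler_int raddfMz lcXn intz. Qed.

Lemma size_subr_lead (c : {poly int}) n : (size c <= n.+1)%N ->
  (size (c - c`_n *: 'X^n)%R <= n)%N.
Proof.
move=> cn; apply/leq_sizeP => j; rewrite leq_eqVlt coefB coefZ coefXn.
case: eqVneq => [<-|_ /= nj]; first by rewrite mulr1 subrr.
by rewrite nth_default ?gtn_eqF ?mulr0 ?subr0 // (leq_trans cn).
Qed.

Lemma mulrz_dvd (G : zmodType) (x : G) (n : nat) (a : int) :
  x *+ n = 0 -> (n %| a)%Z -> x *~ a = 0.
Proof.
by move=> xn /dvdzP[q ->]; rewrite mulrC mulrzA -[x *~ n]/(x *+ n) xn mul0rz.
Qed.

Lemma mulrz_modz (G : zmodType) (x : G) (n : nat) (a : int) :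
  x *+ n = 0 -> x *~ (a %% n)%Z = x *~ a.
Proof.
move=> xn; rewrite [in RHS](divz_eq a n) [RHS]mulrzDr.
by rewrite [x *~ (_ * _)](mulrz_dvd xn) ?add0r // dvdz_mull.
Qed.

(** * Greedy construction of independent sequences *)

Section Span.
Variables (G : zmodType) (W : G -> Prop).
Hypothesis WS : is_subgroup W.

Definition span (x : nat -> G) n : set G :=
  [set s | exists w c, [/\ W w, (size (c : {poly int}) <= n)%N & s = w + lc x c]].

Lemma span_subgroup x n : is_subgroup (span x n).
Proof.
split; first by exists 0, 0; rewrite size_poly0 raddf0 addr0; case: WS.
move=> _ _ [w [c [Ww cn ->]]] [v [d [Wv dn ->]]]; exists (w - v), (c - d).
rewrite raddfB addrACA -opprD; split=> //; first exact: WS.2.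
by rewrite (leq_trans (size_polyD _ _)) // size_polyN geq_max cn.
Qed.

Lemma span0 x : span x 0 = W.
Proof.
apply/seteqP; split=> [_ [w [c [Ww + ->]]]|w Ww].
  by rewrite leqn0 size_poly_eq0 => /eqP->; rewrite raddf0 addr0.
by exists w, 0; rewrite size_poly0 raddf0 addr0.
Qed.

Lemma spanS x n :
  span x n.+1 = [set s | exists u (a : int), span x n u /\ s = u + x n *~ a].
Proof.
apply/seteqP; split=> [_ [w [c [Ww cn ->]]]|_ [_ [a [[w [c [Ww cn ->]]] ->]]]].
  exists (w + lc x (c - c`_n *: 'X^n)), c`_n; split.
    by exists w, (c - c`_n *: 'X^n); split=> //; apply: size_subr_lead.
  by rewrite raddfB lcZXn -addrA subrK.
exists w, (c + a *: 'X^n); split=> //; last by rewrite raddfD lcZXn addrA.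
rewrite (leq_trans (size_polyD _ _)) // geq_max (leq_trans cn) //=.
by rewrite (leq_trans (size_scale_leq _ _)) // size_polyXn.
Qed.

Lemma greedy_sequence (S : nat -> set G) : exists x : nat -> G, forall i,
  (exists2 s, S i s & ~ span x i s) -> S i (x i) /\ ~ span x i (x i).
Proof.
pose next (A : set G) i := xget 0 (S i `\` A).
(* The next term depends on the earlier ones only through their span, so the recursion runs on the
   spans [A i] and the sequence is read off afterwards. *)
pose fix A i : set G := if i is j.+1 then
  [set s | exists u (a : int), A j u /\ s = u + next (A j) j *~ a] else W.
pose x i := next (A i) i.
have spanA i : span x i = A i.
  by elim: i => [|i IH]; rewrite ?span0 ?spanS ?IH.
exists x => i [s Ss]; rewrite spanA => As.
by apply: (@xgetPex _ 0 (S i `\` A i)); exists s.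
Qed.

Lemma finite_span p x n : (0 < p)%N -> (forall i, x i *+ p = 0) ->
  finite_set W -> finite_set (span x n).
Proof.
move=> p0 xp fW; elim: n => [|n IH]; first by rewrite span0.
have := finite_image2 (fun u a => u + x n *+ a) IH (finite_II p).
apply: sub_finite_set; rewrite spanS => _ [u [a [Su ->]]].
exists u => //; exists `|(a %% p)%Z|%N.
  by rewrite /= -ltz_nat gez0_abs ?modz_ge0 ?ltz_pmod // gt_eqF.
rewrite -[x n *+ _]/(x n *~ `|(a %% p)%Z|%N) gez0_abs ?modz_ge0 ?gt_eqF //.
by rewrite mulrz_modz.
Qed.

Lemma prime_bezout p (a : int) : prime p -> ~~ (p %| a)%Z ->
  exists u v : int, u * a + v * p = 1.
Proof.
move=> pp pa; have : coprimez a p.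
  by rewrite coprimezE coprime_sym prime_coprime.
by case/coprimezP => -[u v] /= uv; exists u, v.
Qed.

(** If p did not divide the top coefficient, a Bezout relation would put [x n] in the span of the
    earlier terms. So the top term vanishes and induction applies to the rest. *)
Lemma avoiding_independent p x n : prime p -> (forall i, (i < n)%N -> x i *+ p = 0) ->
  (forall i, (i < n)%N -> ~ span x i (x i)) ->
  forall c : {poly int}, (size c <= n)%N -> W (lc x c) -> forall i, (p %| c`_i)%Z.
Proof.
move=> pp; elim: n => [|n IH] xp xn c cn Wc.
  by move=> i; rewrite nth_default ?dvdz0 // (leq_trans cn).
have pcn : (p %| c`_n)%Z.
  apply/negPn/negP => /(prime_bezout pp)[u [v uv]]; apply: (xn n) => //.
  have -> : x n = (x n *~ c`_n) *~ u.
    rewrite -mulrzA -[LHS]mulr1z -uv mulrzDr mulrC.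
    by rewrite [x n *~ (v * p)](mulrz_dvd (xp n _)) ?addr0 // dvdz_mull.
  apply: (subgroupMz (span_subgroup x n)).
  exists (lc x c), (- (c - c`_n *: 'X^n)); rewrite size_polyN size_subr_lead //.
  by split=> //; rewrite raddfN raddfB lcZXn opprB addrC subrK.
have xpn : x n *~ c`_n = 0.
  by apply: mulrz_dvd pcn; apply: xp.
have := IH _ _ (c - c`_n *: 'X^n) (size_subr_lead cn).
rewrite raddfB lcZXn xpn subr0 => H i.
have {H} := H _ _ Wc i; rewrite coefB coefZ coefXn.
case: eqVneq => [->//|_]; rewrite mulr0 subr0; apply.
  by move=> j jn; apply: xp; apply: ltnW.
by move=> j jn; apply: xn; apply: ltnW.
Qed.

Lemma independent_sequence p (S : nat -> set G) : prime p -> finite_set W ->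
  (forall i x, S i x -> x *+ p = 0) -> (forall i, infinite_set (S i)) ->
  exists x, (forall i, S i (x i)) /\
    forall c, W (lc x c) -> forall i, (p %| c`_i)%Z.
Proof.
move=> pp fW Sp Sinf; have [x xP] := greedy_sequence S.
have {}xP i : S i (x i) /\ ~ span x i (x i).
  elim/ltn_ind: i => i IH; apply: xP.
  (* [finite_span] wants every term killed by p, which is known only below [i]; the truncated
     sequence has the same span. *)
  pose x' j := if (j < i)%N then x j else 0.
  have xx' : span x i = span x' i.
    by apply/seteqP; split=> _ [w [c [Ww ci ->]]]; exists w, c; split=> //;
       congr (w + _); apply: eq_lc => j jc; rewrite /x' (leq_trans jc ci).
  have fspan : finite_set (span x i).
    rewrite xx'; apply: (@finite_span p) => // [|j]; first exact: prime_gt0.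
    by rewrite /x'; case: ifP => [/IH[/Sp]|_]; rewrite ?mul0rn.
  have /infinite_setN0[s [Ss sx]] := infinite_setD (Sinf i) fspan.
  by exists s.
exists x; split=> [i|c Wc]; first by case: (xP i).
apply: (avoiding_independent pp _ _ (leqnn (size c)) Wc) => i _; last by case: (xP i).
by apply: (Sp i); case: (xP i).
Qed.

End Span.

(** The greedy choice produces distinct elements of a finite set, so it stops; the least index at
    which nothing is left to choose is the dimension. *)
Lemma socle_basis (G : zmodType) p : prime p -> finite_set [set x : G | x *+ p = 0] ->
  exists n (x : nat -> G), [/\ forall i, (i < n)%N -> x i *+ p = 0,
    forall c : {poly int}, (size c <= n)%N -> lc x c = 0 -> forall i, (p %| c`_i)%Z &
    forall s, s *+ p = 0 -> exists2 c, (size (c : {poly int}) <= n)%N & s = lc x c].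
Proof.
move=> pp fS; set S := [set x | _] in fS.
have WS : is_subgroup (fun g : G => g = 0) by split=> // _ _ -> ->; rewrite subr0.
have [x xP] := greedy_sequence (fun g : G => g = 0) (fun=> S).
have [n nP] : exists n, ~ exists2 s, S s & ~ span (fun g => g = 0) x n s.
  apply: contrapT => /forallNP H; apply: infinite_nat.
  have {}xP i : S (x i) /\ ~ span (fun g => g = 0) x i (x i).
    by apply: xP; apply: contrapT (H i).
  have xlt i j : (i < j)%N -> x i <> x j.
    move=> ij xij; case: (xP j) => _; apply; exists 0, 'X^i.
    by rewrite size_polyXn add0r lcXn.
  have -> : [set: nat] = x @^-1` S by apply/seteqP; split=> // i _; case: (xP i).
  apply: finite_preimage fS => i j _ _ xij.
  by case: (ltngtP i j) => // /xlt; rewrite xij.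
pose Q n := `[< ~ exists2 s, S s & ~ span (fun g => g = 0) x n s >].
have exQ : exists n, Q n by exists n; apply/asboolP.
have [{nP}m /asboolP mP mmin] := ex_minnP exQ.
have xm i : (i < m)%N -> S (x i) /\ ~ span (fun g => g = 0) x i (x i).
  move=> im; apply: xP; apply: contrapT => /asboolP /mmin.
  by rewrite leqNgt im.
exists m, x; split=> [i /xm[]//|c cm c0|s Ss].
  by apply: (avoiding_independent WS pp _ _ cm c0) => i /xm[].
have [//|nspan] := pselect (exists2 c, (size (c : {poly int}) <= m)%N & s = lc x c).
case: mP; exists s => // -[w [c [w0 cm sE]]]; apply: nspan.
by exists c => //; rewrite sE w0 add0r.
Qed.

(** * Ranks of Bassian groups *)

Definition torsion_at (G : zmodType) p (x : G) : Prop := exists n, x *+ p ^ n = 0.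

(** The socle of p^k G. *)
Definition high_socle (G : zmodType) p k : set G :=
  [set x | x *+ p = 0 /\ exists g, x = g *+ p ^ k].

Lemma high_socle_subgroup (G : zmodType) p k : is_subgroup (@high_socle G p k).
Proof.
split; first by rewrite /high_socle /= mul0rn; split=> //; exists 0; rewrite mul0rn.
move=> x y [xp [g xg]] [yp [h yh]]; rewrite /high_socle /= mulrnBl xp yp subrr.
by split=> //; exists (g - h); rewrite mulrnBl xg yh.
Qed.

Lemma mulrz_natC (G : zmodType) (x : G) (a : int) n : x *~ a *+ n = x *+ n *~ a.
Proof. by rewrite !pmulrn -!mulrzA mulrC. Qed.

(** Elements [x i] of the socle of p^(v i) G are chosen independent modulo [W], and [b i] is a root:
    [x i = b i *+ p ^ v i]. Since [W] contains the socle of mG, the independence lifts to the [b i]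
    modulo mG. *)
Lemma independent_lift (G : zmodType) p (v : nat -> nat) (W : G -> Prop) m :
  prime p -> is_subgroup W -> finite_set W ->
  (forall g, g *+ m *+ p = 0 -> W (g *+ m)) ->
  (forall i, infinite_set (@high_socle G p (v i))) ->
  exists b : nat -> G, (forall i, b i *+ p ^ (v i).+1 = 0) /\
    forall c g, lc b c = g *+ m -> forall i, ((p ^ (v i).+1)%N %| c`_i)%Z.
Proof.
move=> pp WS fW Wm Sinf.
have [|x [xS xW]] := independent_sequence WS (S := fun i => high_socle p (v i)) pp fW _ Sinf.
  by move=> i x [].
have {xS} /choice[b bP] : forall i, exists b, x i = b *+ p ^ v i /\ x i *+ p = 0.
  by move=> i; case: (xS i) => xp [b xb]; exists b.
have bp i : b i *+ p ^ (v i).+1 = 0 by have [xb] := bP i; rewrite xb -mulrnA expnSr.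
exists b; split=> // c g cg.
pose V := \max_(i < size c) v i.
have vV i : (i < size c)%N -> (v i <= V)%N.
  by move=> ic; apply: (@leq_bigmax _ (fun j : 'I_(size c) => v j) (Ordinal ic)).
(* Multiplied by p^(V - t), the relation loses the terms with t < V - v_i, and any other becomes
   [x i] times the quotient of c_i by p^(t - (V - v_i)). The sum lies in mG and is killed by p,
   hence is in [W], so p divides these quotients. At t = V + 1 the exponent is v_i + 1. *)
have step t : (t <= V.+1)%N -> forall i, (i < size c)%N ->
    ((p ^ (t - (V - v i)))%N %| c`_i)%Z.
  elim: t => [|t IH] tV i ic; first by rewrite sub0n expn0 dvd1z.
  have {}IH := IH (ltnW tV).
  pose d := \poly_(i < size c) (if (V - v i <= t)%N
    then (c`_i %/ (p ^ (t - (V - v i)))%N)%Z else 0).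
  have dE : lc x d = (g *+ p ^ (V - t)) *+ m.
    rewrite -mulrnA mulnC mulrnA -cg /lc /= (@lc_funE _ _ _ (size c)) ?size_poly //.
    rewrite /lc_fun -sumrMnl; apply: eq_bigr => -[j /= jc] _.
    rewrite coef_poly jc; case: leqP => tj; last first.
      rewrite mulr0z mulrz_natC.
      have -> : (V - t = (v j).+1 + (V - t - (v j).+1))%N.
        by rewrite subnKC // ltn_subRL addnC -ltn_subRL.
      by rewrite expnD mulrnA bp mul0rn mul0rz.
    have := IH j jc; set a := (t - _)%N => pc.
    rewrite (bP j).1 -[in RHS](divzK pc) mulrz_natC mulrC mulrzA.
    rewrite -[_ *~ (p ^ a)%N]/(_ *+ (p ^ a)%N) -mulrnA -expnD; congr (_ *+ (p ^ _) *~ _).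
    by have := vV _ jc; rewrite /a; lia.
  have dp : lc x d *+ p = 0.
    rewrite /lc /= /lc_fun -sumrMnl big1 // => j _.
    by rewrite mulrz_natC (bP j).2 mul0rz.
  have [ti|ti] := leqP (V - v i) t; last first.
    by rewrite (eqP (ti : (t.+1 - (V - v i) == 0)%N)) expn0 dvd1z.
  have Wd : W (lc x d) by rewrite dE; apply: Wm; rewrite -dE.
  have := xW _ Wd i; rewrite coef_poly ic ti => /(dvdz_mul (dvdzz (p ^ (t - (V - v i)))%N)).
  by rewrite [X in (_ %| X)%Z -> _]mulrC divzK ?IH // -PoszM -expnSr subSn.
move=> i; have [ic|ic] := ltnP i (size c); last by rewrite nth_default // dvdz0.
by have := step _ (leqnn _) _ ic; rewrite subSn ?leq_subr // subKn ?vV.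
Qed.

Lemma lc_polyXn (R : nzRingType) c : lc (fun i => 'X^i : {poly R}) c = map_poly intr c.
Proof.
by rewrite /map_poly poly_def; apply: eq_bigr => i _; rewrite scaler_int.
Qed.

Lemma divisible_mod_poly_Zp m : (1 < m)%N -> divisible_mod m {poly 'Z_m}.
Proof.
move=> m1 d k e d0 dk ek.
pose q i : nat := e`_i; exists (\poly_(i < size e) (q i %/ d)%:R).
apply/polyP => i; rewrite coefMn coef_poly; case: ltnP => ie; last first.
  by rewrite mul0rn nth_default.
have := congr1 (fun r : {poly 'Z_m} => r`_i) ek; rewrite coefMn coef0 => eik.
have kd : (d %| q i)%N.
  have : (m %| q i * k)%N.
    by rewrite /dvdn -val_Zp_nat // natrM natr_Zp mulr_natr eik.
  by rewrite -dk dvdn_pmul2r //; move: (ltnW m1); rewrite -dk muln_gt0; case/andP.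
by rewrite -mulrnA divnK // natr_Zp.
Qed.

Lemma intr_Zp_eq0 m (a : int) : (1 < m)%N -> (a%:~R == 0 :> 'Z_m) = (m %| a)%Z.
Proof.
move=> m1.
have natP n : (n%:R == 0 :> 'Z_m) = (m %| n)%N by rewrite -val_eqE /= val_Zp_nat.
by case: a => n; rewrite ?NegzE ?rmorphN ?oppr_eq0 ?dvdzN; apply: natP.
Qed.

Lemma divisible_mod0_torsionfree (V : lmodType rat) : divisible_mod 0 V.
Proof.
move=> d k e d0 _ _; exists (d%:R^-1 *: e).
by rewrite -scaler_nat scalerA divff ?scale1r // pnatr_eq0 -lt0n.
Qed.

Lemma free_not_Bassian (G : zmodType) (f : {additive {poly int} -> G}) :
  injective f -> ~ Bassian G.
Proof.
(* E = Q[X] is countable, so [unpickle] enumerates it, with 0 at the codes of no element. *)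
move=> fi; pose y i : {poly rat} := odflt 0 (unpickle i).
have lcf c : lc (fun i => f 'X^i) c = f c.
  rewrite -[in RHS](@map_poly_id _ intr c) => [|x _]; last exact: intz.
  by rewrite -lc_polyXn raddf_lc.
apply: (@independent_not_Bassian G {poly rat} 0 (fun i => f 'X^i) (fun=> 0%N) y
  (fun i => 'X^i)) => //.
- exact: divisible_mod0_torsionfree.
- by move=> c g; rewrite lcf mulr0n -(raddf0 f) => /fi -> i; rewrite coef0.
- by move=> e; exists (pickle e); rewrite /y pickleK.
- move=> c /eqP; rewrite lc_polyXn => /eqP c0 i; rewrite dvd0z -(intr_eq0 rat).
  by have := congr1 (fun q : {poly rat} => q`_i) c0; rewrite coef_map coef0 => ->.
Qed.

(** Here m = p^(k+1) and E is a countable sum of copies of Z/m. The finite socle of mG serves as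
    [W]: independence modulo it makes the span of the [b i] meet mG trivially. *)
Lemma finite_layer_not_Bassian (G : zmodType) p k : prime p ->
  infinite_set (@high_socle G p k) -> finite_set (@high_socle G p k.+1) ->
  ~ Bassian G.
Proof.
move=> pp Sk Sk1; set m := (p ^ k.+1)%N.
have m1 : (1 < m)%N by rewrite -(exp1n k.+1) ltn_exp2r // prime_gt1.
have [|b [bm bP]] := independent_lift (v := fun=> k) (m := m) pp
  (@high_socle_subgroup G p k.+1) Sk1 _ (fun=> Sk).
  by move=> g gmp; split=> //; exists g.
pose y i : {poly 'Z_m} := odflt 0 (unpickle i).
have Em (e : {poly 'Z_m}) : e *+ m = 0.
  by apply/polyP => i; rewrite coefMn coef0 -mulr_natr pchar_Zp ?mulr0.
apply: (@independent_not_Bassian G {poly 'Z_m} m b (fun=> m) y (fun i => 'X^i)) => //.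
- exact: divisible_mod_poly_Zp.
- by move=> i; rewrite gtn_eqF.
- by move=> e; exists (pickle e); rewrite /y pickleK.
- move=> c; rewrite lc_polyXn => c0 i; rewrite -intr_Zp_eq0 //.
  by have := congr1 (fun q : {poly 'Z_m} => q`_i) c0; rewrite coef_map coef0 => ->.
Qed.

Section PruferSum.
Variable p : nat.
Hypothesis pp : prime p.

(* The quotient of Q[X] by Z_(p)[X] is a countable sum of copies of Z(p^oo). *)
Definition p_integral (q : {poly rat}) : Prop :=
  exists2 s : nat, coprime s p & exists c, q *+ s = map_poly intr (c : {poly int}).

Lemma p_integral_subgroup : is_subgroup p_integral.
Proof.
split; first by exists 1%N; rewrite ?coprime1n //; exists 0; rewrite mul0rn rmorph0.
move=> x y [s sp [c xc]] [t tp [d yd]]; exists (s * t)%N; first by rewrite coprimeMl sp.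
exists (c *+ t - d *+ s); rewrite rmorphB !rmorphMn /= -xc -yd.
by rewrite mulrnBl [in X in _ - X]mulnC !mulrnA.
Qed.

Lemma p_integral_torsion q : exists n, p_integral (q *+ p ^ n).
Proof.
have [c [a a0 qE]] := rat_poly_scale q.
have qa : q *~ a = map_poly intr c.
  by rewrite qE -scaler_int scalerA divff ?scale1r // intr_eq0.
have [|s ps aE] := @pfactor_coprime p `|a| pp; first by rewrite absz_gt0.
exists (logn p `|a|), s; first by rewrite coprime_sym.
rewrite -mulrnA mulnC -aE; case: a qa {a0 qE aE} => n qn; first by exists c.
exists (- c); rewrite rmorphN /= -qn NegzE mulrNz opprK //.
Qed.

(** Independence in the quotient of the classes of p^(-o_i) X^i, which serve as images under Phi.
    The denominator [s] is prime to p and cancels from the divisibility. *)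
Lemma p_integral_coef (o : nat -> nat) (c : {poly int}) :
  p_integral (lc (fun i => (p ^ o i)%:R^-1 *: 'X^i) c) ->
  forall i, ((p ^ o i)%N %| c`_i)%Z.
Proof.
move=> [s sp [d dE]] i.
have := congr1 (fun q : {poly rat} => q`_i) dE; rewrite coefMn coef_map.
have -> : (lc (fun i => (p ^ o i)%:R^-1 *: 'X^i) c : {poly rat})`_i
    = (p ^ o i)%:R^-1 *~ c`_i.
  have -> : lc (fun i => (p ^ o i)%:R^-1 *: 'X^i) c =
      \poly_(i < size c) ((p ^ o i)%:R^-1 *~ c`_i) :> {poly rat}.
    by rewrite poly_def; apply: eq_bigr => j _; rewrite scalerMzl.
  by rewrite coef_poly; case: ltnP => // ic; rewrite nth_default.
have po : (p ^ o i)%:R != 0 :> rat by rewrite pnatr_eq0 -lt0n expn_gt0 prime_gt0.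
rewrite -mulrzr -[_ *+ s]mulr_natr -mulrA => /(canRL (mulVKf po)) /= cs.
have {}cs : c`_i * s%:Z = (p ^ o i)%N%:Z * d`_i.
  by apply: (@intr_inj rat); rewrite !rmorphM.
have : ((p ^ o i)%N %| c`_i * s%:Z)%Z by rewrite cs dvdz_mulr.
by rewrite Gauss_dvdzl // coprimezE /= coprimeXl // coprime_sym.
Qed.

End PruferSum.

(** The target dictates the orders: each [y i] in the enumeration of E is killed by some p^(v i +
    1), and as every layer is infinite there is an independent sequence [b] of exactly these
    orders. *)
Lemma infinite_layers_not_Bassian (G : zmodType) p : prime p ->
  (forall k, infinite_set (@high_socle G p k)) -> ~ Bassian G.
Proof.
move=> pp Sk.
have [E [pi [pisurj piK]]] := quotient_type (p_integral_subgroup p).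
pose y i : E := pi (odflt 0 (unpickle i)).
have /choice[v vP] : forall i, exists v, y i *+ p ^ v.+1 = 0.
  move=> i; have [n nP] := p_integral_torsion pp (odflt 0 (unpickle i)).
  by exists n; rewrite /y expnSr mulrnA -[pi _ *+ _]raddfMn (piK _).2 // mul0rn.
pose z' i : {poly rat} := (p ^ (v i).+1)%:R^-1 *: 'X^i.
have W0 : is_subgroup (fun g : G => g = 0) by split=> // _ _ -> ->; rewrite subr0.
have [|b [bm bP]] := independent_lift (v := v) (m := 0) pp W0 (finite_set1 0) _ (fun=> Sk _).
  by move=> g _; rewrite mulr0n.
apply: (@independent_not_Bassian G E 0 b (fun i => p ^ (v i).+1)%N y (pi \o z')) => //.
- move=> d k e d0 _ _; have [q <-] := pisurj e.
  have [u ->] := divisible_mod0_torsionfree d0 (muln0 d) (mulr0n q).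
  by exists (pi u); rewrite raddfMn.
- by move=> i; rewrite -(exp1n (v i).+1) gtn_eqF // ltn_exp2r // prime_gt1.
- by move=> e; have [q <-] := pisurj e; exists (pickle q); rewrite /y pickleK.
- move=> i; rewrite /= -raddfMn; apply/piK.
  exists 1%N; rewrite ?coprime1n //; exists 'X^i; rewrite mulr1n map_polyXn.
  by rewrite -scaler_nat scalerA divff ?scale1r // pnatr_eq0 -lt0n expn_gt0 prime_gt0.
- by move=> c; rewrite -raddf_lc => /piK /p_integral_coef; apply.
Qed.

Lemma infinite_socle_not_Bassian (G : zmodType) p : prime p ->
  infinite_set [set x : G | x *+ p = 0] -> ~ Bassian G.
Proof.
move=> pp S0; have [Sinf|/existsNP[k0 /contrapT Sk0]] :=
    pselect (forall k, infinite_set (@high_socle G p k)).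
  exact: infinite_layers_not_Bassian Sinf.
pose Q k := `[< finite_set (@high_socle G p k) >].
have exQ : exists k, Q k by exists k0; apply/asboolP.
(* The least finite layer is not layer 0, which is G[p]; so it follows an infinite one. *)
have [[|k] /asboolP Sk kmin] := ex_minnP exQ.
  case: S0; apply: sub_finite_set Sk => x xp; split=> //.
  by exists x; rewrite expn0 mulr1n.
apply: (finite_layer_not_Bassian pp _ Sk) => /asboolP/kmin.
by rewrite ltnn.
Qed.

(** * Divisible subgroups of the p-torsion part *)

Lemma finite_uniform_bound (T : eqType) (A : set T) (Q : T -> nat -> Prop) :
  finite_set A -> (forall a n m, (n <= m)%N -> Q a n -> Q a m) ->
  (forall a, A a -> exists n, Q a n) -> exists n, forall a, A a -> Q a n.
Proof.
move=> /finite_seqP[s sA] Qmono exQ.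
have /choice[f fP] : forall a, exists n, A a -> Q a n.
  move=> a; have [/exQ[n Qn]|nA] := pselect (A a); first by exists n.
  by exists 0%N => /nA.
exists (\max_(a <- s) f a) => a Aa; apply: Qmono (fP a Aa).
by apply: leq_bigmax_seq => //; move: Aa; rewrite sA.
Qed.

Definition divisible_set (G : zmodType) (S : G -> Prop) : Prop :=
  forall n x, (0 < n)%N -> S x -> exists2 y, S y & x = y *+ n.

(** The subgroup p^k T_p. *)
Definition power_torsion (G : zmodType) p k : set G :=
  [set x | exists2 y, torsion_at p y & x = y *+ p ^ k].

Lemma torsion_at_subgroup (G : zmodType) p : is_subgroup (@torsion_at G p).
Proof.
split=> [|x y [n xn] [m ym]]; first by exists 0%N; rewrite mul0rn.
by exists (n + m)%N; rewrite mulrnBl {1}expnD mulrnA xn mul0rn addnC expnD mulrnA ym mul0rn subrr.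
Qed.

Lemma power_torsion_subgroup (G : zmodType) p k : is_subgroup (@power_torsion G p k).
Proof.
split; first by exists 0; [exact: (torsion_at_subgroup G p).1|by rewrite mul0rn].
move=> _ _ [x tx ->] [y ty ->]; exists (x - y); last by rewrite mulrnBl.
exact: (torsion_at_subgroup G p).2.
Qed.

Lemma coprime_torsion_unit (G : zmodType) (x : G) s n : coprime s n -> x *+ n = 0 ->
  exists u, x = x *+ (u * s).
Proof.
move=> sn xn; have [n0|n0] := posnP n.
  move: sn xn; rewrite n0 /coprime gcdn0 => /eqP-> _.
  by exists 1%N; rewrite muln1 mulr1n.
have [s0|s0] := posnP s.
  move: sn xn; rewrite s0 /coprime gcd0n => /eqP->; rewrite mulr1n => ->.
  by exists 0%N; rewrite mul0rn.
have [u v uv _] := egcdnP n s0; exists u.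
by rewrite uv (eqP (sn : gcdn s n == 1%N)) mulrnDr mulr1n mulnC mulrnA xn mul0rn add0r.
Qed.

(* The decreasing finite groups (p^k T_p)[p] are eventually constant. *)
Lemma divisible_core (G : zmodType) p : prime p -> finite_set [set x : G | x *+ p = 0] ->
  exists k, divisible_set (@power_torsion G p k).
Proof.
move=> pp fS.
have [k kP] : exists k, forall x : G, high_socle p k x -> forall j, high_socle p j x.
  pose Q (x : G) k := high_socle p k x -> forall j, high_socle p j x.
  have [||k kP] := finite_uniform_bound (Q := Q) fS.
  - move=> x n m nm Qn [xp [g xg]]; apply: Qn; split=> //.
    by exists (g *+ p ^ (m - n)); rewrite -mulrnA -expnD subnK.
  - move=> x xp; have [H|/existsNP[j Hj]] := pselect (forall j, high_socle p j x).
      by exists 0%N.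
    by exists j => /Hj.
  by exists k => x xk; apply: (kP x) => //; case: xk.
exists k.
(* Induction on the exponent of [x]: the last nonzero multiple by a power of p lies in the stable
   socle, so it is [g *+ p ^ (n + k.+1)], and subtracting [g *+ p ^ k.+1] from [x] lowers the
   exponent. *)
have step n (x : G) : power_torsion p k x -> x *+ p ^ n = 0 ->
    exists2 y, torsion_at p y & x = y *+ p ^ k.+1.
  elim: n x => [|n IH] x xk xn.
    by exists 0; [exact: (torsion_at_subgroup G p).1|by rewrite mul0rn -[LHS]mulr1n].
  have [xnp [g xg]] : high_socle p (n + k.+1) (x *+ p ^ n).
    apply: kP; split; first by rewrite -mulrnA -expnSr.
    by have [y _ ->] := xk; exists (y *+ p ^ n); rewrite -!mulrnA mulnC.
  have tg : torsion_at p g.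
    by exists (n + k.+1 + 1)%N; rewrite expnD mulrnA -xg -mulrnA -expnD addn1.
  have [||y ty yE] := IH (x - g *+ p ^ k.+1).
  - apply: (power_torsion_subgroup G p k).2 => //; exists (g *+ p).
      by case: tg => a ga; exists a; rewrite -mulrnA mulnC mulrnA ga mul0rn.
    by rewrite -mulrnA expnS.
  - by rewrite mulrnBl xg -mulrnA -expnD addnC subrr.
  exists (y + g); first exact: (subgroupD (torsion_at_subgroup G p)).
  by rewrite mulrnDl -yE subrK.
have divp a (x : G) : power_torsion p k x -> exists2 y, power_torsion p k y & x = y *+ p ^ a.
  elim: a x => [|a IH] x xk; first by exists x.
  have [y yk ->] := IH x xk.
  have [n yn] : torsion_at p y.
    by case: yk => z tz ->; apply: (subgroupMn (torsion_at_subgroup G p)).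
  have [z tz ->] := step n y yk yn; exists (z *+ p ^ k); first by exists z.
  by rewrite -!mulrnA -!expnD addSnnS.
(* Only the p-part of [n] matters: the cofactor [s] acts invertibly on p-torsion. *)
move=> n x n0 xk; have [s ps nE] := pfactor_coprime pp n0.
have [y yk ->] := divp (logn p n) x xk.
have [b yb] : torsion_at p y.
  by case: yk => z tz ->; apply: (subgroupMn (torsion_at_subgroup G p)).
have [u yu] : exists u, y = y *+ (u * s).
  by apply: coprime_torsion_unit yb; rewrite coprimeXr // coprime_sym.
exists (y *+ u); first exact: (subgroupMn (power_torsion_subgroup G p k)).
by rewrite [in LHS]yu [in RHS]nE -!mulrnA mulnA.
Qed.

Definition bounded_torsion_at (G : zmodType) p : Prop :=
  exists k, forall x : G, torsion_at p x -> x *+ p ^ k = 0.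

(** K is the divisible group p^k T_p. Without an element of order p it would be zero, and p^k would
    bound T_p. *)
Lemma unbounded_divisible (G : zmodType) p : prime p ->
  finite_set [set x : G | x *+ p = 0] -> ~ bounded_torsion_at G p ->
  exists (K : zmodType) (e : {additive K -> G}),
    [/\ injective e, divisible_mod 0 K & exists x : K, x <> 0 /\ x *+ p = 0].
Proof.
move=> pp fS unb; have [k kdiv] := divisible_core pp fS.
have [K [e [ei eK]]] := subgroup_type (power_torsion_subgroup G p k).
exists K, e; split=> //.
  move=> d j x d0 _ _; have [|y Sy xy] := kdiv d (e x) d0.
    by apply/eK; exists x.
  have [z ez] := (eK y).1 Sy; exists z; apply: ei.
  by rewrite raddfMn ez.
apply: contrapT => noK; apply: unb; exists k => x tx.
have /eK[z zE] : power_torsion p k (x *+ p ^ k) by exists x.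
rewrite -zE; have [n xn] := tx.
have : z *+ p ^ n = 0.
  by apply: ei; rewrite raddfMn raddf0 zE -mulrnA mulnC mulrnA xn mul0rn.
elim: n {xn} => [|n IH]; first by rewrite mulr1n => ->; rewrite raddf0.
rewrite expnSr mulrnA => zn; apply: IH; apply: contrapT => zn0.
by apply: noK; exists (z *+ p ^ n).
Qed.

(** With K divisible, Phi extends the identity of K to G and Theta is p times Phi: on K it is onto
    by divisibility and kills an element of order p. *)
Lemma Bassian_bounded_torsion (G : zmodType) p : prime p -> Bassian G ->
  finite_set [set x : G | x *+ p = 0] -> bounded_torsion_at G p.
Proof.
move=> pp BG fS; apply: contrapT => /(unbounded_divisible pp fS).
move=> [K [e [ei divK [x [x0 xp]]]]]; move: BG.
have [Ph PhE] := additive_extension_hom (idfun : {additive K -> K}) divK ei.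
have [Th ThE] : exists Th : {additive G -> K}, Th =1 fun g => Ph g *+ p.
  by apply: additive_of => g h; rewrite raddfB mulrnBl.
apply: (@not_Bassian G K (fun g => exists k, e k = g) Th Ph).
- split=> [|_ _ [a <-] [b <-]]; first by exists 0; rewrite raddf0.
  by exists (a - b); rewrite raddfB.
- move=> a; have [b ->] := divK p 0%N a (prime_gt0 pp) (muln0 p) (mulr0n a).
  by exists (e b); [exists b|rewrite ThE PhE].
- exists (e x); split; [by exists x| |by rewrite ThE PhE].
  by rewrite -(raddf0 e) => /ei.
- by move=> _ [a <-]; rewrite PhE /= => ->; rewrite raddf0.
Qed.

(** This expresses that r_0 is finite, the additive group of Z[X] being free of countable rank. *)
Definition no_free_subgroup (G : zmodType) : Prop :=
  forall f : {additive {poly int} -> G}, ~ injective f.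

Definition finite_socles (G : zmodType) : Prop :=
  forall p, prime p -> finite_set [set x : G | x *+ p = 0].

Definition bounded_torsions (G : zmodType) : Prop :=
  forall p, prime p -> bounded_torsion_at G p.

Lemma torsion_socle (G : zmodType) (x : G) n : (0 < n)%N -> x *+ n = 0 -> x <> 0 ->
  exists p j, [/\ prime p, x *+ j <> 0 & x *+ j *+ p = 0].
Proof.
move=> n0 xn x0.
have exQ : exists m, (0 < m)%N && (x *+ m == 0) by exists n; rewrite n0 xn eqxx.
have [m /andP[m0 /eqP xm] mmin] := ex_minnP exQ.
have m1 : (1 < m)%N by case: m m0 xm {mmin} => [|[|]] //; rewrite mulr1n.
have dm := pdiv_dvd m; have pm := pdiv_prime m1.
exists (pdiv m), (m %/ pdiv m)%N; split=> //; last by rewrite -mulrnA divnK.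
move=> /eqP xj; have := mmin (m %/ pdiv m)%N.
rewrite xj andbT divn_gt0 ?prime_gt0 // dvdn_leq // => /(_ isT).
by rewrite leqNgt ltn_Pdiv // prime_gt1.
Qed.

Lemma finite_torsion_at (G : zmodType) p : finite_set [set x : G | x *+ p = 0] ->
  bounded_torsion_at G p -> finite_set [set x : G | torsion_at p x].
Proof.
move=> fS [k kP]; apply: (@sub_finite_set _ _ [set x : G | x *+ p ^ k = 0]) => [x /kP//|].
elim: k {kP} => [|k IH].
  by apply: sub_finite_set (finite_set1 (0 : G)) => x /=; rewrite mulr1n.
(* Multiplication by p maps G[p^(k+1)] to G[p^k] with fibres in cosets of G[p]; [r] picks a point of
   each nonempty fibre. *)
have /choice[r rP] : forall a : G, exists y, forall x, x *+ p = a -> y *+ p = a.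
  move=> a; have [[x xa]|na] := pselect (exists x, x *+ p = a); first by exists x.
  by exists 0 => x xa; case: na; exists x.
apply: sub_finite_set (finite_image2 (fun a s => r a + s) IH fS) => x /= xk.
exists (x *+ p); first by rewrite /= -mulrnA -expnS.
exists (x - r (x *+ p)); last by rewrite addrC subrK.
by rewrite /= mulrnBl (rP _ x) // subrr.
Qed.

Lemma lc_cons (G : zmodType) (b : nat -> G) (c : {poly int}) a :
  lc b (c * 'X + a%:P : {poly int}) = b 0%N *~ a + lc (b \o succn) c.
Proof.
have sz : (size (c * 'X + a%:P : {poly int})%R <= (size c).+1)%N.
  rewrite (leq_trans (size_polyD _ _)) // geq_max.
  by rewrite (leq_trans (size_polyMleq _ _)) ?size_polyX ?addn2 // (leq_trans (size_polyC_leq1 _)).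
rewrite /lc /= (lc_funE _ sz) big_ord_recl coefD coefMX coefC /= add0r.
by congr (_ + _); apply: eq_bigr => i _; rewrite coefD coefMX coefC /= addr0.
Qed.

(* If pi is onto with kernel element h and f is injective, the sequence
   h = h_0, pi (h_(i+1)) = f (h_i) is independent when h has infinite order,
   and consists of distinct elements otherwise. *)
Theorem Bassian_of_ranks (G : zmodType) :
  no_free_subgroup G -> finite_socles G -> bounded_torsions G -> Bassian G.
Proof.
move=> nF fS bT Q pi f pis fi.
have /choice[s sP] : forall g, exists h, pi h = f g by move=> g; apply: pis.
have torsK h : pi h = 0 -> exists2 n, (0 < n)%N & h *+ n = 0.
  move=> pih; apply: contrapT => nt.
  apply: (nF (lc (fun i => iter i s h))); apply: raddf_inj => c.
  (* Applying [pi] to the relation kills the term in [h] and turns the shifted sequence into the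
     image of the original one under [f], so the quotient by X gives a relation again. *)
  elim/poly_ind: c => [//|c a IH]; rewrite lc_cons /= => c0.
  have {}IH : c = 0.
    apply/IH/fi; rewrite raddf0 -(raddf0 pi) -c0 raddfD raddfMz pih mul0rz add0r.
    by rewrite !raddf_lc; apply: eq_lc => i _; rewrite /= sP.
  move: c0; rewrite IH raddf0 addr0 mul0r add0r => ha.
  have [->//|a0] := eqVneq a 0; case: nt; exists `|a|%N; rewrite ?absz_gt0 //.
  by case: a ha {a0} => n //; rewrite NegzE mulrNz => /eqP; rewrite oppr_eq0 => /eqP.
(* The kernel of [pi] being torsion, any lift [s g] is torsion. Multiplying it by [u * r], with [r]
   the prime-to-p part of the order [N] and [u * r] fixing [g], leaves a p-torsion lift. *)
have tors_lift p g : prime p -> torsion_at p g -> exists2 g', torsion_at p g' & pi g' = f g.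
  move=> pp [n gn]; have [N N0 sN] : exists2 m, (0 < m)%N & s g *+ p ^ n *+ m = 0.

    by apply: torsK; rewrite raddfMn sP -raddfMn gn raddf0.
  have [r pr NE] := pfactor_coprime pp N0.
  have [u gu] : exists u, g = g *+ (u * r).
    by apply: coprime_torsion_unit gn; rewrite coprimeXr // coprime_sym.
  exists (s g *+ (u * r)); last by rewrite raddfMn sP -raddfMn -gu.
  exists (n + logn p N)%N; rewrite -mulrnA expnD.
  have -> : (u * r * (p ^ n * p ^ logn p N) = p ^ n * (r * p ^ logn p N) * u)%N by lia.
  by rewrite -NE mulrnA [_ *+ (_ * N)]mulrnA sN mul0rn.
apply: raddf_inj => h pih; apply: contrapT => h0.
have [n n0 hn] := torsK h pih.
have [p [j [pp hj0 hjp]]] := torsion_socle n0 hn h0.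
have /choice[t tP] : forall g, exists g', torsion_at p g ->
    torsion_at p g' /\ pi g' = f g.
  move=> g; have [/(tors_lift p g pp)[g' tg' fg]|ng] := pselect (torsion_at p g).
    by exists g'.
  by exists 0.
pose x i := iter i t (h *+ j).
have xt i : torsion_at p (x i).
  elim: i => [|i /tP[]//]; first by exists 1%N; rewrite expn1.
have xS i : pi (x i.+1) = f (x i) by have [] := tP _ (xt i).
have x_neq0 i : x i <> 0.
  elim: i => [//|i IH] xi0; apply/IH/fi.
  by rewrite -xS xi0 !raddf0.
have x0S i : x 0%N <> x i.+1.
  move=> /(congr1 pi); rewrite xS /= raddfMn pih mul0rn -(raddf0 f) => /fi.
  by move/esym; apply: x_neq0.
have xi : injective x.
  elim=> [|a IH] [|b] //; [by move/x0S|by move/esym/x0S|].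
  by move/(congr1 pi); rewrite !xS => /fi/IH->.
apply: infinite_nat.
have -> : [set: nat] = x @^-1` [set y | torsion_at p y] by apply/seteqP; split=> // i _; apply: xt.
by apply: finite_preimage (finite_torsion_at (fS p pp) (bT p pp)) => a b _ _ /xi.
Qed.

Theorem Bassian_ranks (G : zmodType) : Bassian G ->
  [/\ no_free_subgroup G, finite_socles G & bounded_torsions G].
Proof.
move=> BG; have fS : finite_socles G.
  by move=> p pp; apply: contrapT => /(infinite_socle_not_Bassian pp).
split=> // [f fi|p pp]; first exact: free_not_Bassian fi BG.
exact: Bassian_bounded_torsion (fS p pp).
Qed.

Section Hereditary.
Variables (G K : zmodType) (e : {additive K -> G}).
Hypothesis ei : injective e.

Lemma no_free_subgroup_sub : no_free_subgroup G -> no_free_subgroup K.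
Proof.
by move=> nF f fi; apply: (nF (e \o f : {additive {poly int} -> G})); apply: inj_comp.
Qed.

Lemma finite_socles_sub : finite_socles G -> finite_socles K.
Proof.
move=> fS p pp; have -> : [set x : K | x *+ p = 0] = e @^-1` [set x | x *+ p = 0].
  apply/seteqP; split=> x /=; rewrite -raddfMn; first by move=> ->; rewrite raddf0.
  by rewrite -(raddf0 e) => /ei.
by apply: finite_preimage (fS p pp) => x y _ _ /ei.
Qed.

Lemma bounded_torsions_sub : bounded_torsions G -> bounded_torsions K.
Proof.
move=> bT p pp; have [k kP] := bT p pp; exists k => x [n xn]; apply: ei.
by rewrite raddfMn raddf0 kP //; exists n; rewrite -raddfMn xn raddf0.
Qed.

End Hereditary.

(** * Subgroups that are not Hopfian or not directly finite *)

Lemma poly_not_directly_finite (R : nzRingType) : ~ directly_finite {poly R}.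
Proof.
apply; have [f fE] : exists f : {additive {poly R} -> {poly R}}, f =1 fun q => q * 'X.
  by apply: additive_of => x y; rewrite mulrBl.
exists f, (fun q => exists a, q = a%:P); split.
- move=> x y; rewrite !fE => xy; apply/polyP => i.
  by have := congr1 (fun r : {poly R} => r`_i.+1) xy; rewrite !coefMX.
- split=> [|_ _ [a ->] [b ->]]; first by exists 0.
  by exists (a - b); rewrite polyCB.
- by exists 1; split; [exists 1|apply/eqP/oner_neq0].
- move=> q _ [a ->]; rewrite fE => /(congr1 (fun r : {poly R} => r`_0)).
  by rewrite coefMX coefC /= => <-.
- elim/poly_ind => [|q a _]; last first.
    by exists q, a%:P; rewrite fE; split=> //; exists a.
  by exists 0, 0; rewrite raddf0 addr0; split=> //; exists 0.
Qed.

Lemma poly_not_Hopfian (R : nzRingType) : ~ Hopfian {poly R}.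
Proof.
have [f fE] : exists f : {additive {poly R} -> {poly R}}, f =1 drop_poly 1.
  by apply: additive_of => x y; rewrite raddfB.
move=> /(_ f) H; have /H fi : forall y, exists x, f x = y.
  by move=> y; exists (y * 'X^1); rewrite fE drop_polyMXn_id.
have /fi/eqP : f 1 = f 0 by rewrite !fE drop_poly0r drop_poly_eq0 ?size_poly1.
by rewrite oner_eq0.
Qed.

Section ZpPolynomials.
Variables (G : zmodType) (p : nat) (x : nat -> G).
Hypotheses (pp : prime p) (xp : forall i, x i *+ p = 0).
Hypothesis xindep : forall c, lc x c = 0 -> forall i, (p %| c`_i)%Z.

(** Representatives of the coefficients; additive only modulo p, which [lc x] does not see because p
    kills every [x i]. *)
Let lift (q : {poly 'Z_p}) : {poly int} := \poly_(i < size q) ((q`_i)%R : 'Z_p)%:Z.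

Let lift_coef (q : {poly 'Z_p}) i : (lift q)`_i = ((q`_i)%R : 'Z_p)%:Z.
Proof. by rewrite coef_poly; case: ltnP => // qi; rewrite nth_default. Qed.

Lemma Zp_poly_embedding : exists f : {additive {poly 'Z_p} -> G}, injective f.
Proof.
have [f fE] : exists f : {additive {poly 'Z_p} -> G}, f =1 fun q => lc x (lift q).
  apply: additive_of => a b; apply/eqP; rewrite -subr_eq0 -!raddfB /=; apply/eqP.
  apply: (lc_eq0 xp) => i; rewrite -(intr_Zp_eq0 _ (prime_gt1 pp)).
  by rewrite !coefB !lift_coef !rmorphB /= -!pmulrn !natr_Zp coefB subrr.
exists f; apply: raddf_inj => q; rewrite fE => /xindep q0; apply/polyP => i.
rewrite coef0 -[q`_i]natr_Zp; apply/eqP; rewrite pmulrn (intr_Zp_eq0 _ (prime_gt1 pp)).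
by rewrite -lift_coef.
Qed.

End ZpPolynomials.

(** The rings Z and Z/p are the ones used: an infinite G[p] contains a copy of (Z/p)[X]. *)
Lemma ranks_of_no_poly (G : zmodType) :
  (forall (R : nzRingType) (f : {additive {poly R} -> G}), ~ injective f) ->
  no_free_subgroup G /\ finite_socles G.
Proof.
move=> nP; split=> [f|p pp]; first exact: nP.
apply: contrapT => Sinf.
have W0 : is_subgroup (fun g : G => g = 0) by split=> // _ _ -> ->; rewrite subr0.
have [|x [xS xi]] := independent_sequence W0 (S := fun=> [set x : G | x *+ p = 0]) pp
  (finite_set1 0) _ (fun=> Sinf); first by [].
by have [f /nP] := Zp_poly_embedding pp xS xi.
Qed.

Lemma hered_Hopfian_ranks (X : zmodType -> Prop) (G : zmodType) :
  subclass X Hopfian -> hered X G ->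
  [/\ no_free_subgroup G, finite_socles G & bounded_torsions G].
Proof.
move=> XH [_ GX]; have [nF fS] : no_free_subgroup G /\ finite_socles G.
  by apply: ranks_of_no_poly => R f /GX/XH/poly_not_Hopfian.
split=> // p pp; apply: contrapT => /(unbounded_divisible pp (fS p pp)).
move=> [K [e [/GX/XH KH divK [x [x0 xp]]]]]; apply: x0.
have [f fE] : exists f : {additive K -> K}, f =1 fun y => y *+ p.
  by apply: additive_of => a b; rewrite mulrnBl.
apply: (KH f); last by rewrite !fE xp mul0rn.
move=> y; have [z ->] := divK p 0%N y (prime_gt0 pp) (muln0 p) (mulr0n y).
by exists z; rewrite fE.
Qed.

(** * The group Q/Z and divisible torsion groups *)

Lemma fracQ_itv x : 0 <= fracQ x < 1.
Proof.
by have := floor_itv x; rewrite /fracQ subr_ge0 ltrBlDl rmorphD.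
Qed.

Lemma fracQ_eq x y (m : int) : 0 <= y < 1 -> x = y + m%:~R -> fracQ x = y.
Proof.
move=> /andP[y0 y1] ->; rewrite /fracQ.
rewrite (floor_def (m := m)) ?addrK // rmorphD /= lerDr y0.
by rewrite addrC ltrD2l.
Qed.

Lemma fracQ_floor x : x = fracQ x + (Num.floor x)%:~R.
Proof. by rewrite subrK. Qed.

Lemma fracQDr x y : fracQ (x + fracQ y) = fracQ (x + y).
Proof.
apply: (@fracQ_eq _ _ (Num.floor (x + y) - Num.floor y)); first exact: fracQ_itv.
by rewrite rmorphB /= /fracQ; ring.
Qed.

(** Q/Z is built on its representatives, so that coordinates are the very rationals that occur in
    [divsum_elt]. *)
Definition QmodZ := {x : rat | 0 <= x < 1}.
HB.instance Definition _ := Choice.copy QmodZ {x : rat | 0 <= x < 1}.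

Definition toQZ (x : rat) : QmodZ := exist _ (fracQ x) (fracQ_itv x).

Lemma toQZ_sval (u : QmodZ) : toQZ (sval u) = u.
Proof.
case: u => x xP; apply: val_inj => /=; apply: (@fracQ_eq _ _ 0) => //.
by rewrite addr0.
Qed.

Definition QZadd (u v : QmodZ) := toQZ (sval u + sval v).
Definition QZopp (u : QmodZ) := toQZ (- sval u).

Fact QZaddA : associative QZadd.
Proof.
move=> u v w; apply: val_inj; rewrite /= fracQDr.
by rewrite [fracQ _ + _]addrC fracQDr addrA [in RHS]addrC.
Qed.

Fact QZaddC : commutative QZadd.
Proof. by move=> u v; rewrite /QZadd addrC. Qed.

Fact QZadd0 : left_id (toQZ 0) QZadd.
Proof.
move=> u; rewrite -[RHS]toQZ_sval; apply: val_inj.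
by rewrite /= addrC fracQDr addr0.
Qed.

Fact QZaddN : left_inverse (toQZ 0) QZopp QZadd.
Proof. by move=> u; apply: val_inj; rewrite /= addrC fracQDr subrr. Qed.

HB.instance Definition _ := GRing.isZmodule.Build QmodZ QZaddA QZaddC QZadd0 QZaddN.

Lemma sval_QZD (u v : QmodZ) : sval (u + v) = fracQ (sval u + sval v).
Proof. by []. Qed.

Lemma sval_QZ0 : sval (0 : QmodZ) = 0.
Proof. by rewrite /= /fracQ floor0 subr0. Qed.

Fact toQZ_is_zmod_morphism : zmod_morphism toQZ.
Proof.
have toD x y : toQZ (x + y) = toQZ x + toQZ y.
  by apply: val_inj; rewrite /= fracQDr [in RHS]addrC fracQDr addrC.
by move=> x y; apply/eqP; rewrite eq_sym subr_eq -toD subrK.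
Qed.

HB.instance Definition _ := GRing.isZmodMorphism.Build rat QmodZ toQZ toQZ_is_zmod_morphism.

Lemma toQZ_eq0 x : toQZ x = 0 <-> exists m : int, x = m%:~R.
Proof.
split=> [/(congr1 sval)|[m ->]].
  by rewrite sval_QZ0 /= => x0; exists (Num.floor x); rewrite [LHS]fracQ_floor x0 add0r.
apply: val_inj; rewrite [RHS]sval_QZ0 /=; apply: (@fracQ_eq _ _ m); last by rewrite add0r.
by rewrite lexx ltr01.
Qed.

Lemma QZ_mulrn_eq0 (u : QmodZ) n : u *+ n = 0 <-> exists m : int, sval u * n%:R = m%:~R.
Proof. by rewrite -toQZ_eq0 mulr_natr raddfMn /= toQZ_sval. Qed.

Lemma QmodZ_divisible : divisible_mod 0 QmodZ.
Proof.
move=> d k u d0 _ _; exists (toQZ (sval u / d%:R)).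
by rewrite -raddfMn -[_ *+ d]mulr_natr divfK /= ?toQZ_sval // pnatr_eq0 -lt0n.
Qed.

Lemma rat_denq_dvd (x : rat) n (m : int) : x * n%:R = m%:~R -> (denq x %| n%:Z)%Z.
Proof.
move=> xn; have : numq x * n%:Z = m * denq x.
  by apply: (@intr_inj rat); rewrite !rmorphM /= numqE -xn mulrAC.
move/(congr1 (fun a => (denq x %| a)%Z)); rewrite [X in _ = X -> _]dvdz_mull //.
by rewrite Gauss_dvdzr // coprimezE coprime_sym coprime_num_den.
Qed.

Lemma QZ_denq (u : QmodZ) p k : prime p -> u *+ p ^ k = 0 ->
  exists j, denq (sval u) = (p ^ j)%N%:Z.
Proof.
move=> pp /QZ_mulrn_eq0[m /rat_denq_dvd dk].
have [j _ jE] : exists2 j, (j <= k)%N & `|denq (sval u)|%N = (p ^ j)%N.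
  by apply/(dvdn_pfactor _ _ pp); move: dk; rewrite dvdzE.
by exists j; rewrite -jE absz_denq.
Qed.

Lemma QZ_denq_mulrn (u : QmodZ) n : denq (sval u) = n%:Z -> u *+ n = 0.
Proof. by move=> dn; apply/QZ_mulrn_eq0; exists (numq (sval u)); rewrite numqE dn. Qed.

Lemma QZ_frac n (u : QmodZ) : (0 < n)%N -> u *+ n = 0 ->
  exists a : int, u = toQZ (n%:R^-1) *~ a.
Proof.
move=> n0 /QZ_mulrn_eq0[m um]; exists m; rewrite -raddfMz -mulrzr -um mulrC mulfK /= ?toQZ_sval //.
by rewrite pnatr_eq0 -lt0n.
Qed.

Lemma QZ_inv_mulz n (a : int) : (0 < n)%N ->
  toQZ (n%:R^-1) *~ a = 0 <-> (n %| a)%Z.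
Proof.
move=> n0; have nn0 : n%:R != 0 :> rat by rewrite pnatr_eq0 -lt0n.
rewrite -raddfMz toQZ_eq0 -mulrzr; split=> [[m /(canRL (mulVKf nn0)) am]|/dvdzP[q ->]].
  apply/dvdzP; exists m; apply: (@intr_inj rat).
  by rewrite am rmorphM mulrC.
by exists q; rewrite rmorphM /= mulrC mulfK.
Qed.

Definition torsion_group (G : zmodType) : Prop :=
  forall x : G, exists2 n, (0 < n)%N & x *+ n = 0.

Section DivisibleSum.
Variables (D : zmodType) (n : nat -> nat).
Hypothesis Dn : iso_divsum D n.

Lemma iso_divsum_coords : exists F : nat -> nat -> {additive D -> QmodZ},
  (forall x, (forall p i, F p i x = 0) -> x = 0) /\
  forall x, divsum_elt n (fun p i => sval (F p i x)).
Proof.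
have [phi [phii phid _ phiD]] := Dn.
have itv p i x : 0 <= phi x p i < 1 by case: (phid x).
have add p i : exists f : {additive D -> QmodZ}, forall x, sval (f x) = phi x p i.
  pose f x : QmodZ := exist _ (phi x p i) (itv p i x).
  have fD x y : f (x + y) = f x + f y by apply: val_inj; rewrite /= phiD.
  have [|g gE] := @additive_of _ _ f; last by exists g => x; rewrite gE.
  by move=> x y; apply/eqP; rewrite eq_sym subr_eq -fD subrK.
have /choice[F FP] : forall u, exists f : {additive D -> QmodZ},
    forall x, sval (f x) = phi x u.1 u.2 by move=> u; apply: add.
exists (fun p i => F (p, i)); split=> x.
  move=> Fx; apply: phii; apply/funext => p; apply/funext => i.
  by rewrite -(FP (p, i)) -(FP (p, i) 0) Fx raddf0.
by rewrite (_ : (fun p i => _) = phi x) //; apply/funext => p; apply/funext => i; apply: FP.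
Qed.

Lemma iso_divsum_torsion : torsion_group D.
Proof.
have [F [F0 Fd] x] := iso_divsum_coords; have [_ dF zF [N FN]] := Fd x.
pose d p i := `|denq (sval (F p i x))|%N.
have d0 p i : (0 < d p i)%N by rewrite absz_gt0 denq_neq0.
(* The product of the denominators at the finitely many places where a coordinate can be nonzero. *)
exists (\prod_(p < N) \prod_(i < n p) d p i)%N.
  by rewrite prodn_gt0 // => p; rewrite prodn_gt0.
apply: F0 => p i; rewrite raddfMn.
have [Np|pN] := leqP N p.
  rewrite (_ : F p i x = 0) ?mul0rn //; apply: val_inj.
  by rewrite [RHS]sval_QZ0 /= FN.
have [ni|ni] := leqP (n p) i.
  rewrite (_ : F p i x = 0) ?mul0rn //; apply: val_inj.
  by rewrite [RHS]sval_QZ0 /= zF //; right.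
have Fd0 : F p i x *+ d p i = 0 by apply: QZ_denq_mulrn; rewrite absz_denq.
rewrite (bigD1 (Ordinal pN)) //= (bigD1 (Ordinal ni)) //= -mulnA mulrnA Fd0.
by rewrite mul0rn.
Qed.

Lemma iso_divsum_finite_socles : finite_socles D.
Proof.
have [F [F0 Fd]] := iso_divsum_coords => p pp.
have Fq q i x : x *+ p = 0 -> q != p \/ (n p <= i)%N -> F q i x = 0.
  move=> xp qp; have [_ dF zF _] := Fd x.
  suff H : sval (F q i x) = 0 by apply: val_inj; rewrite [RHS]sval_QZ0.
  have [pq|npq] := boolP (prime q); last by apply: zF; left.
  case: (eqVneq q p) qp => [->|qp _]; first by case=> // ni; apply: zF; right.
  (* The denominator is a power of q dividing p, hence 1, and the coordinate is an integer in [0,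
     1). *)
  have [k kE] := dF q i.
  have /QZ_mulrn_eq0[m /rat_denq_dvd] : F q i x *+ p = 0 by rewrite -raddfMn xp raddf0.
  rewrite kE dvdzE !absz_nat => dvp; have : coprime (q ^ k) p.
    by rewrite coprimeXl // prime_coprime // dvdn_prime2.
  rewrite /coprime (gcdn_idPl dvp) => /eqP q1.
  have := numqE (sval (F q i x)); rewrite kE q1 mulr1 => FE.
  have [+ _ _ _] := Fd x => /(_ q i); rewrite -FE.
  rewrite ler0z ltrz1; case: (numq _) => [[|a]|a] //.
(* For [u] killed by p this is the integer p u in [0, p), so [Psi] embeds the socle in a finite
   set. *)
pose c (u : QmodZ) := numq (sval u * p%:R).
have cE (u : QmodZ) : u *+ p = 0 -> (c u)%:~R = sval u * p%:R.
  by move=> /QZ_mulrn_eq0[m um]; rewrite /c um numq_int.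
have p0 : p%:R != 0 :> rat by rewrite pnatr_eq0 -lt0n prime_gt0.
pose Psi x := [ffun i : 'I_(n p) => inord `|c (F p i x)| : 'I_p.+1].
have c_itv x i : x *+ p = 0 -> 0 <= c (F p i x) < p%:Z.
  move=> xp; have [/(_ p i)/andP[x0 x1] _ _ _] := Fd x.
  have Fp : F p i x *+ p = 0 by rewrite -raddfMn xp raddf0.
  rewrite -(ler_int rat) -(ltr_int rat) cE // mulr_ge0 ?ler0n //=.
  by rewrite -[X in _ < X]mul1r ltr_pM2r // ltr0n prime_gt0.
have Psi_inj x y : x *+ p = 0 -> y *+ p = 0 -> Psi x = Psi y -> x = y.
  move=> xp yp /ffunP xy; apply/eqP; rewrite -subr_eq0; apply/eqP/F0 => q i.
  have xyp : (x - y) *+ p = 0 by rewrite mulrnBl xp yp subr0.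
  have [qp|qp] := eqVneq q p; last by apply: Fq => //; left.
  have [ni|ni] := leqP (n p) i; first by apply: Fq => //; right.
  rewrite qp raddfB; apply/eqP; rewrite subr_eq0; apply/eqP/val_inj.
  have := xy (Ordinal ni); rewrite !ffunE /= => /(congr1 val) /=.
  have /andP[x0 x1] := c_itv x i xp; have /andP[y0 y1] := c_itv y i yp.
  rewrite !inordK; try by rewrite ltnS; lia.
  move=> cxy; apply: (mulIf p0); rewrite -!cE; try by rewrite -raddfMn ?xp ?yp raddf0.
  by rewrite -(gez0_abs x0) -(gez0_abs y0) cxy.
have /choice[r rP] : forall g, exists x, forall y, y *+ p = 0 -> Psi y = g -> y = x.
  move=> g; have [[x xp xg]|nx] := pselect (exists2 x, x *+ p = 0 & Psi x = g).
    by exists x => y yp yg; apply: Psi_inj; rewrite ?yg.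
  by exists 0 => y yp yg; case: nx; exists y.
apply: sub_finite_set (finite_image r (@finite_finset _ setT)) => x xp.
by exists (Psi x) => //; apply/esym/rP.
Qed.

End DivisibleSum.

(** * Rank conditions for extended Bassian groups *)

Lemma ext_Bassian_ranks (G : zmodType) :
  ext_Bassian G -> no_free_subgroup G /\ finite_socles G.
Proof.
move=> [B [D [n [BB Dn [h [h' hK h'K]]]]]]; have hi := can_inj hK.
have [nF fS _] := Bassian_ranks BB.
suff [nF' fS'] : no_free_subgroup (B * D)%type /\ finite_socles (B * D)%type.
  by split; [apply: no_free_subgroup_sub hi nF'|apply: finite_socles_sub hi fS'].
split=> [f fi|p pp].
  (* Projection to B keeps [f] injective: if it kills [f c], then [f c] lies in the torsion group D,
     so [c *+ m = 0] with [m > 0], and Z[X] is torsion-free. *)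
  apply: (nF (@fst B D \o f)); apply: raddf_inj => c /= fc0.
  have [m m0 fm] := iso_divsum_torsion Dn (f c).2.
  have : c *+ m = 0.
    apply: fi; rewrite raddfMn raddf0; have := raddfMn (@fst B D) m (f c).
    have := raddfMn (@snd B D) m (f c) => /=; rewrite fm fc0 mul0rn.
    by case: (f c *+ m) => a b /= -> ->.
  move=> cm; apply/polyP => i; have := congr1 (fun q : {poly int} => q`_i) cm.
  by rewrite coefMn coef0 => /eqP; rewrite mulrn_eq0 eqn0Ngt m0 => /eqP.
apply: sub_finite_set (finite_setX (fS p pp) (iso_divsum_finite_socles Dn pp)) => u up.
split=> /=; first by have := raddfMn (@fst B D) p u => /= <-; rewrite up.
by have := raddfMn (@snd B D) p u => /= <-; rewrite up.
Qed.

(** Coordinates in a basis of G[p], with values in multiples of 1/p, extend to G since Q/Z is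
    divisible. They are made to vanish on torsion prime to p, so that different primes do not
    interfere. *)
Lemma socle_coords (G : zmodType) p : prime p -> finite_set [set x : G | x *+ p = 0] ->
  exists n (F : nat -> {additive G -> QmodZ}), [/\
    forall i x, (n <= i)%N -> F i x = 0,
    forall i x s, coprime s p -> x *+ s = 0 -> F i x = 0,
    forall x, x *+ p = 0 -> (forall i, F i x = 0) -> x = 0 &
    forall a : nat -> QmodZ, (forall i, a i *+ p = 0) -> (forall i, (n <= i)%N -> a i = 0) ->
      exists2 x, x *+ p = 0 & forall i, F i x = a i].
Proof.
move=> pp fS; have [n [x [xp xindep xspan]]] := socle_basis pp fS.
have p0 := prime_gt0 pp; pose e := toQZ (p%:R^-1).
have ext i : exists f : {additive G -> QmodZ}, [/\ (n <= i)%N -> forall g, f g = 0,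
    (i < n)%N -> forall c, (size (c : {poly int}) <= n)%N -> f (lc x c) = e *~ c`_i &
    forall g s, coprime s p -> g *+ s = 0 -> f g = 0].
  have [ni|ni] := leqP n i.
    have [f fE] := @additive_of G QmodZ (fun=> 0) (fun _ _ => esym (subr0 0)).
    by exists f; split=> *; rewrite fE.
  have [||f fP] := additive_extension QmodZ_divisible (Gam := fun g u => exists c t s,
      [/\ (size (c : {poly int}) <= n)%N, coprime s p, t *+ s = 0, g = lc x c + t &
          u = e *~ c`_i]).
  - split.
      exists 0, 0, 1%N; rewrite size_poly0 coprime1n mul0rn addr0 coef0 mulr0z.
      by split=> //; rewrite !raddf0.
    move=> [_ _] [_ _] [c [t [s [cn sp ts /= -> ->]]]] [d [r [q [dn qp rq /= -> ->]]]].
    exists (c - d), (t - r), (s * q)%N; split.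
    + by rewrite (leq_trans (size_polyD _ _)) // size_polyN geq_max cn.
    + by rewrite coprimeMl sp.
    + by rewrite mulrnBl mulrnA ts mul0rn mulnC mulrnA rq mul0rn subrr.
    + by rewrite raddfB addrACA -opprD.
    + by rewrite coefB mulrzBr.
  - move=> g u [c [t [s [cn sp ts gE ->]]]]; apply/(QZ_inv_mulz _ p0).
    (* Multiplying by [s] removes the summand [t]; as [s] is prime to p, divisibility of s c_i by p
       gives that of c_i. *)
    have /(xindep (c *+ s)) : lc x (c *+ s) = 0.
      by rewrite raddfMn -[LHS]addr0 -ts -mulrnDl -gE mulr0n mul0rn.
    rewrite -scaler_nat => /(_ (leq_trans (size_scale_leq _ _) cn) i).
    rewrite coefZ Gauss_dvdzr //.
    by rewrite coprimezE natz absz_nat coprime_sym.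
  exists f; split=> [//|_ c cn|g s sp gs].
    apply: fP; exists c, 0, 1%N.
    by rewrite coprime1n mul0rn addr0.
  apply: fP; exists 0, g, s; rewrite size_poly0 raddf0 add0r coef0 mulr0z.
  by split.
have /choice[F FP] := ext; exists n, F; split.
- by move=> i g ni; have [->] := FP i.
- by move=> i g s sp gs; have [_ _ H] := FP i; apply: H sp gs.
- move=> g /xspan[c cn ->] Fc; rewrite /lc /= /lc_fun big1 // => i _.
  have ni : (i < n)%N := leq_trans (ltn_ord i) cn.
  apply: mulrz_dvd (xp _ ni) _; apply/(QZ_inv_mulz _ p0).
  by have [_ <-] := FP i.
- move=> a ap an; have /choice[m mE] : forall i, exists m : int, a i = e *~ m.
    by move=> i; apply: QZ_frac p0 (ap i).
  exists (lc x (\poly_(i < n) m i)).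
    rewrite /lc /= /lc_fun -sumrMnl big1 // => i _; rewrite mulrz_natC xp ?mul0rz //.
    exact: leq_trans (ltn_ord i) (size_poly _ _).
  move=> i; have [F0 FE _] := FP i; have [ni|ni] := leqP n i; first by rewrite F0 ?an.
  by rewrite FE ?size_poly // coef_poly ni.
Qed.

(** The socle coordinates, extended to D, give the isomorphism. If all of them kill [x], a multiple
    of [x] in a socle vanishes and the exponent of [x] drops; surjectivity climbs up from the socles
    by divisibility. *)
Lemma iso_divsum_of_socles (D : zmodType) : divisible_mod 0 D -> torsion_group D ->
  finite_socles D -> exists n, iso_divsum D n.
Proof.
move=> divD torD fS.
have /choice[nF nFP] : forall p, exists nF : nat * (nat -> {additive D -> QmodZ}),
    prime p -> [/\ forall i x, (nF.1 <= i)%N -> nF.2 i x = 0,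
    forall i x s, coprime s p -> x *+ s = 0 -> nF.2 i x = 0,
    forall x, x *+ p = 0 -> (forall i, nF.2 i x = 0) -> x = 0 &
    forall a : nat -> QmodZ, (forall i, a i *+ p = 0) ->
      (forall i, (nF.1 <= i)%N -> a i = 0) ->
      exists2 x, x *+ p = 0 & forall i, nF.2 i x = a i].
  move=> p; have [pp|np] := boolP (prime p).
    by have [n [F FP]] := socle_coords pp (fS p pp); exists (n, F).
  have [f _] := @additive_of D QmodZ (fun=> 0) (fun _ _ => esym (subr0 0)).
  by exists (0%N, fun=> f).
(* At indices that are not prime the coordinates are 0, as [divsum_elt] demands. *)
pose n p := (nF p).1; pose F p i x : QmodZ := if prime p then (nF p).2 i x else 0.
have FD p i x y : F p i (x + y) = F p i x + F p i y.
  by rewrite /F; case: ifP => _; rewrite ?raddfD ?addr0.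
have FB p i x y : F p i (x - y) = F p i x - F p i y.
  by rewrite /F; case: ifP => _; rewrite ?raddfB ?subrr.
have F0 p i : F p i 0 = 0 by rewrite /F; case: ifP => _; rewrite ?raddf0.
have FM p i x k : F p i (x *+ k) = F p i x *+ k.
  by rewrite /F; case: ifP => _; rewrite ?raddfMn ?mul0rn.
have Fsum p i (I : Type) (r : seq I) (P : pred I) (x : I -> D) :
    F p i (\sum_(j <- r | P j) x j) = \sum_(j <- r | P j) F p i (x j).
  by apply: big_morph => // a b; apply: FD.
have F_coprime p i x s : coprime s p -> x *+ s = 0 -> F p i x = 0.
  move=> sp xs; rewrite /F; case: ifP => // /nFP[_ H _ _]; exact: H sp xs.
have F_inj x : (forall p i, F p i x = 0) -> x = 0.
  have [m m0 xm] := torD x; elim/ltn_ind: m x m0 xm => m IH x m0 xm Fx.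
  have [m1|m1] := leqP m 1.
    by case: m m0 m1 xm {IH} => [|[|]] //; rewrite mulr1n.
  have pp := pdiv_prime m1; have dm := pdiv_dvd m.
  have dm0 : (0 < m %/ pdiv m)%N by rewrite divn_gt0 ?prime_gt0 // dvdn_leq.
  apply: (IH _ _ x dm0 _ Fx); first by rewrite ltn_Pdiv // prime_gt1.
  have [_ _ + _] := nFP _ pp; apply; first by rewrite -mulrnA divnK.
  by move=> i; have := FM (pdiv m) i x (m %/ pdiv m)%N; rewrite Fx mul0rn /F pp.
(* Induction on [k]: realize p a by [x] and divide [x] by p; the error in the coordinates is killed
   by p and is corrected in the socle. *)
have F_surj p k (a : nat -> QmodZ) : prime p -> (forall i, a i *+ p ^ k = 0) ->
    (forall i, (n p <= i)%N -> a i = 0) ->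
    exists2 x, x *+ p ^ k = 0 & forall i, F p i x = a i.
  move=> pp; elim: k a => [|k IH] a ak an.
    by exists 0; rewrite ?mul0rn // => i; rewrite F0 -(ak i) expn0 mulr1n.
  have [|i ni|x xk xa] := IH (fun i => a i *+ p); last 1 first.
  - have [y xy] := divD p 0%N x (prime_gt0 pp) (muln0 p) (mulr0n x).
    have [_ _ _ /(_ (fun i => a i - F p i y))[||z zp za]] := nFP _ pp.
    + by move=> i; rewrite mulrnBl -FM -xy xa subrr.
    + move=> i ni; rewrite an // /F pp; have [-> //] := nFP _ pp; exact: subr0.
    exists (y + z); last by move=> i; rewrite FD [F p i z]/F pp za addrC subrK.
    by rewrite expnS mulrnA mulrnDl -xy zp addr0.
  - by move=> i; rewrite -mulrnA -expnS.
  - by rewrite an ?mul0rn.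
have F_tors p i x s : x *+ s = 0 -> (0 < s)%N -> prime p -> F p i x *+ p ^ logn p s = 0.
  move=> xs s0 pp; have [r pr sE] := pfactor_coprime pp s0.
  rewrite -FM; apply: (F_coprime _ _ _ r); first by rewrite coprime_sym.
  by rewrite -mulrnA mulnC -sE.
exists n, (fun x p i => sval (F p i x)); split.
- move=> x y xy; apply/eqP; rewrite -subr_eq0; apply/eqP/F_inj => p i.
  rewrite FB; apply/eqP; rewrite subr_eq0; apply/eqP/val_inj.
  exact: (congr1 (fun f => f p i) xy).
- move=> x; split=> [p i|p i|p i|]; first exact: valP (F p i x).
  + have [pp|np] := boolP (prime p); last first.
      by exists 0%N; rewrite /F (negPf np) sval_QZ0.
    by have [m m0 xm] := torD x; apply: QZ_denq pp (F_tors p i x m xm m0 pp).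
  + rewrite -[RHS]sval_QZ0 /F; case: ifP => // pp [//|ni].
    by have [->] := nFP _ pp.
  + have [m m0 xm] := torD x; exists m.+1 => p i mp.
    rewrite -[RHS]sval_QZ0; congr sval.
    have [pp|np] := boolP (prime p); last by rewrite /F (negPf np).
    apply: F_coprime xm; rewrite coprime_sym prime_coprime // gtnNdvd //.
- move=> f [f01 fd fz [N fN]].
  pose a p i : QmodZ := exist _ (f p i) (f01 p i).
  have a0 p i : f p i = 0 -> a p i = 0 by move=> fpi; apply: val_inj; rewrite [RHS]sval_QZ0.
  have /choice[x xP] : forall p, exists x, prime p ->
      (exists k, x *+ p ^ k = 0) /\ forall i, F p i x = a p i.
    move=> p; have [pp|np] := boolP (prime p); last by exists 0.
    have /choice[k kP] : forall i, exists k, a p i *+ p ^ k = 0.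
      by move=> i; have [k kE] := fd p i; exists k; apply: QZ_denq_mulrn.
    have [||y yk ya] := F_surj p (\max_(i < n p) k i) (a p) pp.
    - move=> i; have [ni|ni] := leqP (n p) i.
        by rewrite a0 ?mul0rn // fz //; right.
      rewrite -(subnKC (@leq_bigmax _ (fun j : 'I_(n p) => k j) (Ordinal ni))).
      by rewrite expnD mulrnA kP mul0rn.
    - by move=> i ni; apply: a0; apply: fz; right.
    by exists y => _; split=> //; exists (\max_(i < n p) k i)%N.
  exists (\sum_(p < N | prime p) x p); apply/funext => q; apply/funext => i.
  have [pq|npq] := boolP (prime q); last first.
    by rewrite /F (negPf npq) sval_QZ0 fz //; left.
  have Fq p : prime p -> p != q -> F q i (x p) = 0.
    move=> pp pq'; have [[k xk] _] := xP p pp; apply: F_coprime xk.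
    by rewrite coprimeXl // prime_coprime // dvdn_prime2.
  rewrite Fsum; have [Nq|qN] := leqP N q.
    rewrite big1 ?sval_QZ0 ?fN // => p pp; apply: Fq => //.
    by rewrite ltn_eqF // (leq_trans (ltn_ord p)).
  have -> : \sum_(p < N | prime p) F q i (x p) = F q i (x q).
    rewrite (bigD1 (Ordinal qN)) //= big1 ?addr0 // => p /andP[pp pq'].
    exact: Fq.
  by have [_ ->] := xP q pq.
- by move=> x y p i; rewrite FD sval_QZD.
Qed.

(** The largest divisible torsion subgroup D is a retract of G, and B is the kernel of the
    retraction. The rank conditions pass to B; its p-torsion is bounded because a divisible p^k T_p
    inside B must lie in D. *)
Theorem ext_Bassian_of_ranks (G : zmodType) :
  no_free_subgroup G -> finite_socles G -> ext_Bassian G.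
Proof.
move=> nF fS.
(* The union of all divisible torsion subgroups; it is a subgroup because the sum of two of them is
   another. *)
pose Dp (x : G) : Prop := exists S : G -> Prop, [/\ is_subgroup S, divisible_set S,
  forall y, S y -> exists2 n, (0 < n)%N & y *+ n = 0 & S x].
have DpS : is_subgroup Dp.
  split.
    exists (fun y => y = 0); split=> //.
    - by split=> // _ _ -> ->; rewrite subr0.
    - by move=> n _ _ ->; exists 0; rewrite ?mul0rn.
    - by move=> _ ->; exists 1%N; rewrite ?mul0rn.
  move=> x y [S [SS divS torS Sx]] [T [TS divT torT Ty]].
  exists (fun z => exists s t, [/\ S s, T t & z = s - t]); split.
  - split; first by exists 0, 0; rewrite subrr; split=> //; [exact: SS.1|exact: TS.1].
    move=> _ _ [s [t [Ss Tt ->]]] [s' [t' [Ss' Tt' ->]]]; exists (s - s'), (t - t').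
    by split; [exact: SS.2|exact: TS.2|rewrite !opprD addrACA].
  - move=> n _ n0 [s [t [Ss Tt ->]]].
    have [s' Ss' ->] := divS n s n0 Ss; have [t' Tt' ->] := divT n t n0 Tt.
    by exists (s' - t'); [exists s', t'|rewrite mulrnBl].
  - move=> _ [s [t [/torS[n n0 sn] /torT[m m0 tm] ->]]].
    exists (n * m)%N; first by rewrite muln_gt0 n0.
    by rewrite mulrnBl mulrnA sn mul0rn mulnC mulrnA tm mul0rn subrr.
  - by exists x, y.
have Dp_div : divisible_set Dp.
  move=> n x n0 [S [SS divS torS /(divS n x n0)[y Sy ->]]].
  by exists y => //; exists S.
have [D [e [ei eD]]] := subgroup_type DpS.
have eDp d : Dp (e d) by apply/eD; exists d.
have divD : divisible_mod 0 D.
  move=> n k d n0 _ _; have [_ /eD[d' <-] dd'] := Dp_div n (e d) n0 (eDp d).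
  by exists d'; apply: ei; rewrite raddfMn.
have torD : torsion_group D.
  move=> d; have [S [_ _ /(_ (e d)) tS /tS[n n0 dn]]] := eDp d.
  by exists n => //; apply: ei; rewrite raddfMn raddf0.
have [n Dn] := iso_divsum_of_socles divD torD (finite_socles_sub ei fS).
have [r rE] := additive_extension_hom (idfun : {additive D -> D}) divD ei.
have kS : is_subgroup (fun g => r g = 0).
  by split=> [|x y rx ry]; rewrite ?raddf0 // raddfB rx ry subrr.
have [B [b [bi bK]]] := subgroup_type kS.
have rb x : r (b x) = 0 by apply/bK; exists x.
have BB : Bassian B.
  apply: Bassian_of_ranks.
  - exact: no_free_subgroup_sub bi nF.
  - exact: finite_socles_sub bi fS.
  - move=> p pp; have fB := finite_socles_sub bi fS pp.
    have [k kdiv] := divisible_core pp fB; exists k => x tx.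
    have : Dp (b (x *+ p ^ k)).
      exists (fun g => exists2 y, power_torsion p k y & g = b y); split.
      + have [H0 HB] := power_torsion_subgroup B p k.
        split=> [|_ _ [y ty ->] [z tz ->]]; first by exists 0; rewrite ?raddf0.
        by exists (y - z); rewrite ?raddfB //; apply: HB.
      + move=> m _ m0 [y /(kdiv m y m0)[z tz ->] ->].
        by exists (b z); [exists z|rewrite raddfMn].
      + move=> _ [_ [z [m zm] ->] ->]; exists (p ^ m)%N; first by rewrite expn_gt0 prime_gt0.
        by rewrite -raddfMn -mulrnA mulnC mulrnA zm mul0rn raddf0.
      + by exists (x *+ p ^ k) => //; exists x.
    (* An element of both B and D is 0: [r] vanishes on B and is the identity on D. *)
    move=> /eD[d db]; have := rE d; rewrite db rb /= => d0.
    by apply: bi; rewrite -db -d0 !raddf0.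
exists B, D, n; split=> //.
have s_ker g : exists x, b x = g - e (r g).
  by apply/bK; rewrite raddfB rE subrr.
have /choice[s sE] := s_ker.
have [h hE] : exists h : {additive G -> (B * D)%type}, h =1 fun g => (s g, r g).
  apply: additive_of => x y; rewrite raddfB; congr (_, _).
  by apply: bi; rewrite [RHS]raddfB !sE raddfB [e _]raddfB opprD addrACA -opprD.
exists h, (fun u => b u.1 + e u.2) => [g|[x d]]; rewrite hE /= ?sE ?subrK //.
have rd : r (b x + e d) = d by rewrite raddfD rb add0r rE.
by congr (_, _) => //; apply: bi; rewrite sE rd addrK.
Qed.

(** * Hereditary parts of the classes *)

Theorem theorem4p4 (X : zmodType -> Prop) (HX : iso_closed X) :
  (subclass ext_Bassian X -> subclass X directly_finite ->
     same_class (hered X) ext_Bassian) /\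
  (subclass Bassian X -> subclass X Hopfian ->
     same_class (hered X) Bassian).
Proof.
split=> EX XY G; split.
- move=> [_ GX]; have [nF fS] : no_free_subgroup G /\ finite_socles G.
    by apply: ranks_of_no_poly => R f /GX/XY/poly_not_directly_finite.
  exact: ext_Bassian_of_ranks.
- move=> EG; split=> [|K e ei]; apply: EX => //; have [nF fS] := ext_Bassian_ranks EG.
  by apply: ext_Bassian_of_ranks; [apply: no_free_subgroup_sub ei nF|
    apply: finite_socles_sub ei fS].
- by move=> /(hered_Hopfian_ranks XY)[nF fS bT]; apply: Bassian_of_ranks.
- move=> BG; split=> [|K e ei]; apply: EX => //; have [nF fS bT] := Bassian_ranks BG.
  apply: Bassian_of_ranks; [exact: no_free_subgroup_sub ei nF|
    exact: finite_socles_sub ei fS|exact: bounded_torsions_sub ei bT].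
Qed.
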